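(* Let $X$ be a smooth complex variety, $f\in\mathcal{O}_X(X)$ a nonzero regular function and $H=\mathrm{div}(f)$. For every $\beta\in\mathbf{Q}$, we have an isomorphism of $\mathcal{D}_X\langle t,t^{-1},s\rangle$-modules $$\Phi\colon\iota_+\mathcal{M}(f^{\beta})\to\iota_+\mathcal{O}_X( *H),$$ where on the right-hand side $\mathcal{D}_X\langle t,t^{-1},s\rangle$ acts via the automorphism $\mathcal{D}_X\langle t,t^{-1},s\rangle\to\mathcal{D}_X\langle t,t^{-1},s\rangle$ that maps $s$ to $s-\beta$ and is the identity on $\mathcal{D}_X$ and on $t$. The isomorphism $\Phi$ is given by $$\Phi\left(\sum_{i=0}^ph_if^{\beta}\otimes\partial_t^i\delta\right)=\sum_{i=0}^pg_i\otimes\partial_t^i\delta,$$ where $$\sum_{i=0}^p\frac{h_i}{f^i}Q_i(-s+\beta)=\sum_{i=0}^p\frac{g_i}{f^i}Q_i(-s)\quad\text{in}\quad\mathcal{O}_X( *H)[s].$$ The isomorphism $\Phi$ translates the $V$-filtration by $-\beta$, in the sense that $$\Phi\big(V^{\gamma}\iota_+\mathcal{M}(f^{\beta})\big)=V^{\gamma-\beta}\iota_+\mathcal{O}_X( *H)\quad\text{for every}\quad\gamma\in\mathbf{Q}.$$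
   Context: $Q_0=1$ and $Q_i(x)=x(x+1)\cdots(x+i-1)\in\mathbf{Z}[x]$ for $i\ge1$. $\mathcal{O}_X( *H)=\bigcup_{m\ge0}\mathcal{O}_X(mH)$, and $\mathcal{M}(f^\beta)=\mathcal{O}_X( *H)f^\beta$ is the free rank one $\mathcal{O}_X( *H)$-module on the symbol $f^\beta$, with $\mathcal{D}_X$-action given by $\xi(wf^\beta)=\big(\xi(w)+w\frac{\beta\,\xi(f)}{f}\big)f^\beta$ for derivations $\xi$ of $\mathcal{O}_X$; for $\beta=0$ it is $\mathcal{O}_X( *H)$. Let $\iota\colon X\hookrightarrow X\times\mathbf{C}$, $x\mapsto(x,f(x))$, with $t$ the coordinate on $\mathbf{C}$. For a $\mathcal{D}_X$-module $\mathcal{M}$, the $\mathcal{D}$-module direct image is $\iota_+\mathcal{M}=\bigoplus_{j\ge0}\mathcal{M}\otimes\partial_t^j\delta$ (viewed as a sheaf on $X$), with actions $t(m\otimes\partial_t^j\delta)=fm\otimes\partial_t^j\delta-jm\otimes\partial_t^{j-1}\delta$, $\partial_t(m\otimes\partial_t^j\delta)=m\otimes\partial_t^{j+1}\delta$, $\xi(m\otimes\partial_t^j\delta)=\xi(m)\otimes\partial_t^j\delta-\xi(f)m\otimes\partial_t^{j+1}\delta$. Elements of $\iota_+\mathcal{M}(f^\beta)$ are written uniquely as finite sums $\sum_jh_jf^\beta\otimes\partial_t^j\delta$ with $h_j\in\mathcal{O}_X( *H)$. Put $s=-\partial_tt$, and let $\mathcal{D}_X\langle t,t^{-1},s\rangle=\mathcal{D}_X\langle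 t,t^{-1},\partial_t\rangle$ be the ring obtained from $\mathcal{D}_X\langle t,\partial_t\rangle$ by inverting $t$ (so $st=t(s-1)$ and $\partial_t=-st^{-1}$). If $f$ acts bijectively on $\mathcal{M}$, then $t$ acts bijectively on $\iota_+\mathcal{M}$, so $\iota_+\mathcal{M}$ is a $\mathcal{D}_X\langle t,t^{-1},s\rangle$-module. A $V$-filtration on $\iota_+\mathcal{M}$ is an exhaustive, decreasing, discrete, left continuous filtration $(V^\gamma)_{\gamma\in\mathbf{Q}}$ (constant on each interval $(\frac{i}{\ell},\frac{i+1}{\ell}]$, $i\in\mathbf{Z}$, for some positive integer $\ell$) such that: (i) each $V^\gamma$ is a coherent $\mathcal{D}_X[t,\partial_tt]$-module; (ii) $tV^\gamma\subseteq V^{\gamma+1}$, with equality if $\gamma>0$; (iii) $\partial_tV^\gamma\subseteq V^{\gamma-1}$; (iv) $\partial_tt-\gamma$ acts nilpotently on $V^\gamma/V^{>\gamma}$, where $V^{>\gamma}=\bigcup_{\gamma'>\gamma}V^{\gamma'}$. It is unique if it exists, and it is known to exist for $\mathcal{M}=\mathcal{O}_X( *H)$ and $\mathcal{M}=\mathcal{M}(f^\beta)$. *)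

(* Defs.v *)
From HB Require Import structures.
From mathcomp Require Import all_boot all_order all_algebra.
From mathcomp Require Import all_classical all_reals topology.
From mathcomp Require Import complex.
From mathcomp Require Import ring.

Set Implicit Arguments.
Unset Strict Implicit.
Unset Printing Implicit Defensive.
Import Order.TTheory GRing.Theory Num.Theory.
Local Open Scope classical_set_scope.
Local Open Scope ring_scope.

(** * Subrings of a field *)

Section CommutativeAlgebra.
Variables (C K : fieldType) (cst : {rmorphism C -> K}).
Implicit Types (A B I J : set K).

Definition is_subalgebra A :=
  [/\ forall c, A (cst c),
      forall a b, A a -> A b -> A (a + b) &
      forall a b, A a -> A b -> A (a * b)].

Definition generated_algebra (S : set K) : set K :=
  [set a | forall B, is_subalgebra B -> S `<=` B -> B a].

Definition is_finitely_generated A :=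
  exists s : seq K, A = generated_algebra [set a | a \in s].

Definition is_ideal A I :=
  [/\ I `<=` A, I 0, forall a b, I a -> I b -> I (a + b) &
      forall a b, A a -> I b -> I (a * b)].

Definition maximal_ideal A : set (set K) :=
  [set I | [/\ is_ideal A I, ~ I 1 &
               forall J, is_ideal A J -> I `<=` J -> ~ J 1 -> J = I]].

Definition prime_ideal A : set (set K) :=
  [set I | [/\ is_ideal A I, ~ I 1 &
               forall a b, A a -> A b -> I (a * b) -> I a \/ I b]].

Definition has_prime_chain A (n : nat) :=
  exists p : nat -> set K,
    (forall i, (i <= n)%N -> prime_ideal A (p i)) /\
    (forall i, (i < n)%N -> p i `<` p i.+1).

Definition krull_dim A n := has_prime_chain A n /\ ~ has_prime_chain A n.+1.

Definition ideal_span A n (s : n.-tuple K) : set K :=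
  [set y | exists2 a : 'I_n -> K, (forall i, A (a i)) &
             y = \sum_(i < n) a i * tnth s i].

(* To be used for a local ring [A], whose maximal ideal is unique *)
Definition regular_local_ring A :=
  exists2 n, krull_dim A n &
    exists s : n.-tuple K, maximal_ideal A (ideal_span A s).

(* The localization of [A] at the complement of the prime ideal [I] *)
Definition localization A I : set K :=
  [set g | exists a b, [/\ A a, A b, ~ I b & g = a / b]].

End CommutativeAlgebra.

(** * Varieties *)

(* An irreducible variety is given by its space of closed points, its function
   field [K], and its structure sheaf, which is a subsheaf of the constant sheaf
   [K]. All the sheaves below are likewise subsheaves of a constant sheaf [E]:
   they are maps [F : set X -> set E], of which only the values at nonempty open
   sets are meaningful, and their restriction maps are inclusions. Since any two
   nonempty open sets meet, compatible local sections are equal elements of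
   [E], so the sheaf axiom takes the form [is_sheaf]. *)

Section Spaces.
Variable X : topologicalType.
Implicit Types U W : set X.

Definition nonempty_open U := open U /\ U !=set0.

Definition open_nbhd_in U (x : X) W := [/\ open W, W x & W `<=` U].

Definition is_sheaf (E : Type) (F : set X -> set E) :=
  (forall U W, nonempty_open U -> nonempty_open W -> W `<=` U -> F U `<=` F W) /\
  (forall U e, nonempty_open U ->
     (forall x, U x -> exists2 W, open_nbhd_in U x W & F W e) -> F U e).

Section Affine.
Variables (C K : fieldType) (cst : {rmorphism C -> K}) (reg : set X -> set K).

(* [phi] identifies [U] with the maximal spectrum of [A], equipped with the
   Zariski topology and its structure sheaf *)
Definition is_affine_open U :=
  nonempty_open U /\
  exists (A : set K) (phi : X -> set K),
    [/\ is_finitely_generated cst A,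
        forall g, exists a b, [/\ A a, A b, b != 0 & g = a / b],
        set_bij U (maximal_ideal A) phi,
        forall W, W `<=` U -> (open W <->
          exists2 S : set K, S `<=` A &
            W = [set x | U x /\ exists2 a, S a & ~ phi x a]) &
        forall W, nonempty_open W -> W `<=` U ->
          reg W = [set g | forall x, W x -> localization A (phi x) g]].

Definition stalk (x : X) : set K :=
  [set g | exists2 U, open U /\ U x & reg U g].

End Affine.
End Spaces.

Record variety (R : realType) := Variety {
  pts :> topologicalType;
  function_field : fieldType;
  cst : {rmorphism R[i] -> function_field};
  reg : set pts -> set function_field;
  pts_irreducible : [set: pts] !=set0 /\
    forall U W : set pts, nonempty_open U -> nonempty_open W -> U `&` W !=set0;
  reg_sheaf : is_sheaf reg;
  reg_subalgebra : forall U : set pts, nonempty_open U ->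
    is_subalgebra cst (reg U);
  affine_cover : exists (n : nat) (U : 'I_n -> set pts),
    (forall i, is_affine_open cst reg (U i)) /\
    (forall x : pts, exists i, U i x);
  separated : forall U W : set pts,
    is_affine_open cst reg U -> is_affine_open cst reg W ->
    is_affine_open cst reg (U `&` W) /\
    reg (U `&` W) = generated_algebra cst (reg U `|` reg W)
}.

Definition is_smooth (R : realType) (X : variety R) :=
  forall x : X, regular_local_ring (stalk (@reg R X) x).

(** * Vector fields and functions with poles along [div f] *)

Section DModules.
Variables (R : realType) (X : variety R).
Local Notation K := (function_field X).
Implicit Types (U W : set X) (a b f : K) (xi eta : K -> K).

Definition rat_cst (q : rat) : K := cst X (ratr q).

(* A derivation of the sheaf of rings [O_X] over [U], extended to [K] *)
Definition vector_field U xi :=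
  [/\ {morph xi : a b / a + b},
      forall a b, xi (a * b) = xi a * b + a * xi b,
      forall c, xi (cst X c) = 0 &
      forall W a, nonempty_open W -> W `<=` U -> reg W a -> reg W (xi a)].

(* [O_X(mH)] for [H = div f], whose local equation is [f] *)
Definition sheaf_mH f (m : nat) U : set K := [set g | reg U (f ^+ m * g)].

Definition sheaf_starH f U : set K :=
  [set g | forall x, U x -> exists m,
             exists2 W, open_nbhd_in U x W & sheaf_mH f m W g].

(** * The sheaf of rings [D_X<t, t^-1, s>] *)

(* Operators are represented by noncommutative polynomials in functions, vector
   fields, [t], [t^-1] and [s]. [dop_eq U] is equality in [D_X<t, t^-1, s>] over
   [U]: on a smooth affine [U], the ring [D_X(U)] is generated by [O(U)] and
   [Der(U)] with the relations [dop_eq_FF], [dop_eq_VV], [dop_eq_FV],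
   [dop_eq_comm] and [dop_eq_bracket]; [t], [t^-1] and [s] commute with it. *)

Inductive dop :=
| DFun of K
| DVec of (K -> K)
| Dt
| Dtinv
| Ds
| DAdd of dop & dop
| DMul of dop & dop.

Fixpoint dop_on U (P : dop) : Prop :=
  match P with
  | DFun a => reg U a
  | DVec xi => vector_field U xi
  | Dt | Dtinv | Ds => True
  | DAdd P Q | DMul P Q => dop_on U P /\ dop_on U Q
  end.

Inductive dop_eq U : dop -> dop -> Prop :=
| dop_eq_refl P : dop_on U P -> dop_eq U P P
| dop_eq_sym P Q : dop_eq U P Q -> dop_eq U Q P
| dop_eq_trans P Q P' : dop_eq U P Q -> dop_eq U Q P' -> dop_eq U P P'
| dop_eq_Add P P' Q Q' :
    dop_eq U P P' -> dop_eq U Q Q' -> dop_eq U (DAdd P Q) (DAdd P' Q')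
| dop_eq_Mul P P' Q Q' :
    dop_eq U P P' -> dop_eq U Q Q' -> dop_eq U (DMul P Q) (DMul P' Q')
| dop_eq_addA P Q P' : dop_on U P -> dop_on U Q -> dop_on U P' ->
    dop_eq U (DAdd P (DAdd Q P')) (DAdd (DAdd P Q) P')
| dop_eq_addC P Q : dop_on U P -> dop_on U Q ->
    dop_eq U (DAdd P Q) (DAdd Q P)
| dop_eq_add0 P : dop_on U P -> dop_eq U (DAdd (DFun 0) P) P
| dop_eq_addN P : dop_on U P -> dop_eq U (DAdd (DMul (DFun (- 1)) P) P) (DFun 0)
| dop_eq_mulA P Q P' : dop_on U P -> dop_on U Q -> dop_on U P' ->
    dop_eq U (DMul P (DMul Q P')) (DMul (DMul P Q) P')
| dop_eq_mul1l P : dop_on U P -> dop_eq U (DMul (DFun 1) P) P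
| dop_eq_mul1r P : dop_on U P -> dop_eq U (DMul P (DFun 1)) P
| dop_eq_mulDl P Q P' : dop_on U P -> dop_on U Q -> dop_on U P' ->
    dop_eq U (DMul (DAdd P Q) P') (DAdd (DMul P P') (DMul Q P'))
| dop_eq_mulDr P Q P' : dop_on U P -> dop_on U Q -> dop_on U P' ->
    dop_eq U (DMul P (DAdd Q P')) (DAdd (DMul P Q) (DMul P P'))
| dop_eq_addFF a b : reg U a -> reg U b ->
    dop_eq U (DAdd (DFun a) (DFun b)) (DFun (a + b))
| dop_eq_FF a b : reg U a -> reg U b ->
    dop_eq U (DMul (DFun a) (DFun b)) (DFun (a * b))
| dop_eq_VV xi eta : vector_field U xi -> vector_field U eta ->
    dop_eq U (DAdd (DVec xi) (DVec eta)) (DVec (fun u => xi u + eta u))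
| dop_eq_FV a xi : reg U a -> vector_field U xi ->
    dop_eq U (DMul (DFun a) (DVec xi)) (DVec (fun u => a * xi u))
| dop_eq_comm a xi : reg U a -> vector_field U xi ->
    dop_eq U (DMul (DVec xi) (DFun a)) (DAdd (DMul (DFun a) (DVec xi)) (DFun (xi a)))
| dop_eq_bracket xi eta : vector_field U xi -> vector_field U eta ->
    dop_eq U (DMul (DVec xi) (DVec eta))
      (DAdd (DMul (DVec eta) (DVec xi)) (DVec (fun u => xi (eta u) - eta (xi u))))
| dop_eq_TF a : reg U a -> dop_eq U (DMul Dt (DFun a)) (DMul (DFun a) Dt)
| dop_eq_TV xi : vector_field U xi ->
    dop_eq U (DMul Dt (DVec xi)) (DMul (DVec xi) Dt)
| dop_eq_SF a : reg U a -> dop_eq U (DMul Ds (DFun a)) (DMul (DFun a) Ds)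
| dop_eq_SV xi : vector_field U xi ->
    dop_eq U (DMul Ds (DVec xi)) (DMul (DVec xi) Ds)
| dop_eq_ST : dop_eq U (DMul Ds Dt) (DMul Dt (DAdd Ds (DFun (- 1))))
| dop_eq_TTinv : dop_eq U (DMul Dt Dtinv) (DFun 1)
| dop_eq_TinvT : dop_eq U (DMul Dtinv Dt) (DFun 1).

(* The automorphism [s |-> s - beta] *)
Fixpoint shift_s (beta : rat) (P : dop) : dop :=
  match P with
  | Ds => DAdd Ds (DFun (- rat_cst beta))
  | DAdd P Q => DAdd (shift_s beta P) (shift_s beta Q)
  | DMul P Q => DMul (shift_s beta P) (shift_s beta Q)
  | _ => P
  end.

(* The subring [D_X[t, d_t t]] of [D_X<t, t^-1, s>]; recall [d_t t = - s] *)
Fixpoint V0_on U (P : dop) : Prop :=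
  match P with
  | DFun a => reg U a
  | DVec xi => vector_field U xi
  | Dt | Ds => True
  | Dtinv => False
  | DAdd P Q | DMul P Q => V0_on U P /\ V0_on U Q
  end.

Definition dop_sum n (P : 'I_n -> dop) : dop :=
  foldr DAdd (DFun 0) [seq P i | i <- enum 'I_n].

(** * The direct image of [M(f^beta)] *)

(* The section [\sum_j h_j f^beta (x) d_t^j delta] is the polynomial
   [\sum_j h_j 'X^j], so that [d_t] is multiplication by ['X]. Recall that
   [M(f^0) = O_X( *H)]. *)

Definition iota_plus f U : set {poly K} :=
  [set p | forall j, sheaf_starH f U p`_j].

Section Action.
Variables (f : K) (beta : rat).
Implicit Type p : {poly K}.

(* The coefficient of [f^beta] in [xi (w f^beta)] *)
Definition vec_Mf xi (w : K) : K := xi w + w * (rat_cst beta * xi f / f).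

Definition vec_act xi p : {poly K} :=
  \poly_(j < size p) vec_Mf xi p`_j - xi f *: ('X * p).

Definition dt_act p : {poly K} := 'X * p.

Definition t_act p : {poly K} := f *: p - p^`().

(* The inverse of [t_act], see [t_actK] and [tinv_actK] *)
Definition tinv_act p : {poly K} :=
  \sum_(k < size p) f ^- k.+1 *: p^`(k).

Definition s_act p : {poly K} := - dt_act (t_act p).

Fixpoint act (P : dop) p : {poly K} :=
  match P with
  | DFun a => a *: p
  | DVec xi => vec_act xi p
  | Dt => t_act p
  | Dtinv => tinv_act p
  | Ds => s_act p
  | DAdd P Q => act P p + act Q p
  | DMul P Q => act P (act Q p)
  end.

End Action.

(** * The direct image is a module over [D_X<t, t^-1, s>] *)

Lemma rat_cst0 : rat_cst 0 = 0.
Proof. by rewrite /rat_cst rmorph0 rmorph0. Qed.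

Lemma reg_rat_cst U q : nonempty_open U -> reg U (rat_cst q).
Proof. by move=> /reg_subalgebra[+ _ _]; apply. Qed.

Lemma reg1 U : nonempty_open U -> reg U (1 : K).
Proof. by move=> /reg_subalgebra[/(_ 1) + _ _]; rewrite rmorph1. Qed.

Lemma reg0 U : nonempty_open U -> reg U (0 : K).
Proof. by move=> /reg_subalgebra[/(_ 0) + _ _]; rewrite rmorph0. Qed.

Lemma regN1 U : nonempty_open U -> reg U (- 1 : K).
Proof. by move=> /reg_subalgebra[/(_ (- 1)) + _ _]; rewrite rmorphN1. Qed.

Lemma regD U a b : nonempty_open U -> reg U a -> reg U b -> reg U (a + b).
Proof. by move=> /reg_subalgebra[_ + _]; apply. Qed.

Lemma regM U a b : nonempty_open U -> reg U a -> reg U b -> reg U (a * b).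
Proof. by move=> /reg_subalgebra[_ _]; apply. Qed.

Lemma regX U a n : nonempty_open U -> reg U a -> reg U (a ^+ n).
Proof.
move=> oU Ua; elim: n => [|n IH]; first by rewrite expr0; exact: reg1.
by rewrite exprS; exact: regM.
Qed.

Section VectorFieldTheory.
Variables (U : set X) (xi : K -> K).
Hypothesis xiU : vector_field U xi.

Lemma vfD a b : xi (a + b) = xi a + xi b.
Proof. by case: xiU. Qed.

Lemma vfM a b : xi (a * b) = xi a * b + a * xi b.
Proof. by case: xiU. Qed.

Lemma vf_cst c : xi (cst X c) = 0.
Proof. by case: xiU. Qed.

Lemma vf0 : xi 0 = 0.
Proof. by have := vf_cst 0; rewrite rmorph0. Qed.

Lemma vf1 : xi 1 = 0.
Proof. by have := vf_cst 1; rewrite rmorph1. Qed.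

Lemma vfN a : xi (- a) = - xi a.
Proof. by apply/eqP; rewrite -addr_eq0 -vfD addNr vf0. Qed.

Lemma vfB a b : xi (a - b) = xi a - xi b.
Proof. by rewrite vfD vfN. Qed.

Lemma vfMn a n : xi (a *+ n) = xi a *+ n.
Proof.
elim: n => [|n IH]; first by rewrite !mulr0n vf0.
by rewrite !mulrS vfD IH.
Qed.

Lemma vfV a : a != 0 -> xi a^-1 = - xi a / a ^+ 2.
Proof.
move=> a0; apply: (mulfI a0); have /eqP := vf1.
rewrite -{1}(divff a0) vfM addrC addr_eq0 => /eqP ->.
by field.
Qed.

End VectorFieldTheory.

Section ActionTheory.
Variables (f : K) (beta : rat).
Hypothesis f0 : f != 0.
Implicit Type p : {poly K}.

Lemma t_act_coef p j : (t_act f p)`_j = f * p`_j - p`_j.+1 *+ j.+1.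
Proof. by rewrite coefB coefZ coef_deriv. Qed.

Lemma t_actD p q : t_act f (p + q) = t_act f p + t_act f q.
Proof. by rewrite /t_act scalerDr derivD opprD addrACA. Qed.

Lemma t_act_inj : injective (t_act f).
Proof.
move=> p q tpq; apply/eqP; rewrite -subr_eq0; apply/negPn/negP => d0.
have /eqP : t_act f (p - q) = 0.
  by apply: (addIr (t_act f q)); rewrite -t_actD subrK add0r.
rewrite subr_eq0 => /eqP H; have := lt_size_deriv d0.
by rewrite -H size_scale // ltnn.
Qed.

Lemma tinv_actK : cancel (tinv_act f) (t_act f).
Proof.
move=> p; rewrite /t_act /tinv_act scaler_sumr raddf_sum /= -sumrB.
transitivity (\sum_(k < size p) (f ^- k *: p^`(k) - f ^- k.+1 *: p^`(k.+1))).
  apply: eq_bigr => k _; rewrite derivZ -derivnS scalerA exprS invfM mulVKf //.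
pose F k := - (f ^- k *: p^`(k)).
rewrite (eq_bigr (fun k : 'I__ => F k.+1 - F k)); last first.
  by move=> k _; rewrite /F opprK addrC.
rewrite -(big_mkord xpredT (fun k => F k.+1 - F k)) telescope_sumr // /F.
rewrite derivn_poly0 // scaler0 oppr0 add0r opprK expr0 invr1 scale1r.
by rewrite derivn0.
Qed.

Lemma t_actK : cancel (t_act f) (tinv_act f).
Proof. by move=> p; apply: t_act_inj; rewrite tinv_actK. Qed.

Lemma tinv_actD p q : tinv_act f (p + q) = tinv_act f p + tinv_act f q.
Proof. by apply: t_act_inj; rewrite t_actD !tinv_actK. Qed.

Lemma s_actD p q : s_act f (p + q) = s_act f p + s_act f q.
Proof. by rewrite /s_act /dt_act t_actD mulrDr opprD. Qed.

Section VecAct.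
Variables (U : set X) (xi : K -> K).
Hypothesis xiU : vector_field U xi.
Local Notation vec := (vec_act f beta xi).

Lemma vec_MfD a b :
  vec_Mf f beta xi (a + b) = vec_Mf f beta xi a + vec_Mf f beta xi b.
Proof. by rewrite /vec_Mf (vfD xiU); ring. Qed.

Lemma vec_Mf0 : vec_Mf f beta xi 0 = 0.
Proof. by rewrite /vec_Mf (vf0 xiU) mul0r addr0. Qed.

Lemma vec_coef p j :
  (vec p)`_j = vec_Mf f beta xi p`_j - xi f * (if j == 0%N then 0 else p`_j.-1).
Proof.
rewrite coefB coef_poly coefZ coefXM; case: ltnP => // pj.
by rewrite [p`_j]nth_default // vec_Mf0.
Qed.

Lemma vec_actD p q : vec (p + q) = vec p + vec q.
Proof.
apply/polyP => j; rewrite coefD !vec_coef !coefD vec_MfD.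
by case: eqP => _; ring.
Qed.

Lemma vec_act_dt p : vec (dt_act p) = dt_act (vec p).
Proof.
apply/polyP => j; rewrite /dt_act coefXM !vec_coef !coefXM.
by case: j => [|j] //=; rewrite vec_Mf0; ring.
Qed.

Lemma vec_actN p : vec (- p) = - vec p.
Proof.
apply/eqP; rewrite -addr_eq0 -vec_actD addNr; apply/eqP/polyP => j.
by rewrite vec_coef !coef0 vec_Mf0 if_same; ring.
Qed.

Lemma vec_actZ a p : vec (a *: p) = a *: vec p + xi a *: p.
Proof.
apply/polyP => j; rewrite vec_coef coefD !coefZ vec_coef /vec_Mf (vfM xiU).
by case: eqP => _; ring.
Qed.

Lemma vec_act_t p : vec (t_act f p) = t_act f (vec p).
Proof.
apply/polyP => -[|j]; rewrite vec_coef !t_act_coef !vec_coef /= /vec_Mf.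
  by rewrite (vfB xiU) (vfM xiU); ring.
by rewrite (vfB xiU) (vfM xiU) (vfMn xiU); ring.
Qed.

Lemma vec_act_s p : vec (s_act f p) = s_act f (vec p).
Proof. by rewrite /s_act vec_actN vec_act_dt vec_act_t. Qed.

End VecAct.

Lemma vec_bracket U xi eta p : vector_field U xi -> vector_field U eta ->
  vec_act f beta xi (vec_act f beta eta p) =
  vec_act f beta eta (vec_act f beta xi p) +
  vec_act f beta (fun u => xi (eta u) - eta (xi u)) p.
Proof.
move=> xiU etaU; have bc nu : vector_field U nu -> nu (rat_cst beta) = 0.
  by move=> nuU; exact: (vf_cst nuU).
have MV mu nu : vector_field U mu -> vector_field U nu ->
    mu (rat_cst beta * nu f / f) =
    rat_cst beta * (mu (nu f) / f - nu f * mu f / f ^+ 2).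
  by move=> muU nuU; rewrite !(vfM muU) (bc _ muU) (vfV muU f0); field.
apply/polyP => j; rewrite coefD (vec_coef xiU) !(vec_coef etaU) (vec_coef xiU).
have -> : (vec_act f beta (fun u => xi (eta u) - eta (xi u)) p)`_j =
    vec_Mf f beta (fun u => xi (eta u) - eta (xi u)) p`_j -
    (xi (eta f) - eta (xi f)) * (if j == 0%N then 0 else p`_j.-1).
  rewrite coefB coef_poly coefZ coefXM; case: ltnP => // pj.
  rewrite [p`_j]nth_default // /vec_Mf.
  by rewrite !(vf0 xiU, vf0 etaU) (subrr 0) mul0r addr0.
case: j => [|j] /=.
  rewrite /vec_Mf !mulr0 !subr0 !(vfD xiU, vfD etaU).
  rewrite (vfM xiU p`_0) (vfM etaU p`_0) (MV _ _ xiU etaU) (MV _ _ etaU xiU).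
  by field.
rewrite (vec_coef xiU) /vec_Mf !(vfB xiU, vfB etaU) !(vfD xiU, vfD etaU).
rewrite (vfM xiU p`_j.+1) (vfM etaU p`_j.+1) (MV _ _ xiU etaU) (MV _ _ etaU xiU).
rewrite (vfM xiU (eta f)) (vfM etaU (xi f)).
move: (if _ then _ else _) => q.
by field.
Qed.

Lemma actD U P p q : dop_on U P ->
  act f beta P (p + q) = act f beta P p + act f beta P q.
Proof.
elim: P p q => [a|xi|||| P IHP Q IHQ|P IHP Q IHQ] p q /=.
- by rewrite scalerDr.
- by move=> xiU; rewrite (vec_actD xiU).
- by rewrite t_actD.
- by rewrite tinv_actD.
- by rewrite s_actD.
- by move=> [UP UQ]; rewrite IHP // IHQ // addrACA.
- by move=> [UP UQ]; rewrite IHQ // IHP.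
Qed.

Lemma act_dop_eq U P Q p : dop_eq U P Q -> act f beta P p = act f beta Q p.
Proof.
move=> PQ; elim: PQ p => {P Q} //=.
- by move=> P Q P' _ H _ H' p; rewrite H.
- by move=> P P' Q Q' _ H _ H' p; rewrite H H'.
- by move=> P P' Q Q' _ H _ H' p; rewrite H' H.
- by move=> *; rewrite addrA.
- by move=> *; rewrite addrC.
- by move=> *; rewrite scale0r add0r.
- by move=> *; rewrite scaleN1r addNr scale0r.
- by move=> *; rewrite scale1r.
- by move=> *; rewrite scale1r.
- by move=> P Q P' UP _ _ p; exact: actD UP.
- by move=> *; rewrite scalerDl.
- by move=> *; rewrite scalerA.
- move=> xi eta xiU etaU p; apply/polyP => j.
  rewrite coefD (vec_coef xiU) (vec_coef etaU) coefB coef_poly coefZ coefXM.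
  move: (if j == _ then _ else _) => q.
  case: ltnP => pj; first by rewrite /vec_Mf; field.
  by rewrite [p`_j]nth_default // (vec_Mf0 xiU) (vec_Mf0 etaU); ring.
- move=> a xi Ua xiU p; apply/polyP => j.
  rewrite coefZ (vec_coef xiU) coefB coef_poly coefZ coefXM.
  move: (if j == _ then _ else _) => q.
  case: ltnP => pj; first by rewrite /vec_Mf; field.
  by rewrite [p`_j]nth_default // (vec_Mf0 xiU); ring.
- by move=> a xi Ua xiU p; rewrite (vec_actZ xiU).
- by move=> xi eta xiU etaU p; exact: (vec_bracket p xiU etaU).
- by move=> a _ p; rewrite /t_act derivZ scalerBr !scalerA mulrC.
- by move=> xi xiU p; rewrite (vec_act_t xiU).
- move=> a _ p; rewrite /s_act /dt_act scalerN; congr (- _).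
  by rewrite scalerAr /t_act derivZ scalerBr !scalerA [a * f]mulrC.
- by move=> xi xiU p; rewrite (vec_act_s xiU).
- move=> p; rewrite scaleN1r /s_act /dt_act /t_act.
  by rewrite !(derivB, derivN, derivM, derivX, derivZ) -!mul_polyC; ring.
- by move=> p; rewrite tinv_actK scale1r.
- by move=> p; rewrite t_actK scale1r.
Qed.

End ActionTheory.

Lemma shift_s_on beta U P : nonempty_open U -> dop_on U P ->
  dop_on U (shift_s beta P).
Proof.
move=> oU; elim: P => //= [|P IHP Q IHQ [/IHP ? /IHQ ?]|P IHP Q IHQ [/IHP ? /IHQ ?]] //.
split=> //; rewrite -mulN1r; apply: regM => //; first exact: regN1.
exact: reg_rat_cst.
Qed.

Lemma dop_eq_on U P Q : nonempty_open U -> dop_eq U P Q ->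
  dop_on U P /\ dop_on U Q.
Proof.
move=> oU; have [[r0 r1] rN1] := (reg0 oU, reg1 oU, regN1 oU).
elim=> {P Q} /=; do ?[by intuition].
- by move=> a b Ua Ub; do ?split=> //; exact: regD.
- by move=> a b Ua Ub; do ?split=> //; exact: regM.
- move=> xi eta xiU etaU; do ?split=> //.
  + by move=> a b; rewrite (vfD xiU) (vfD etaU) addrACA.
  + by move=> a b; rewrite (vfM xiU) (vfM etaU); ring.
  + by move=> c; rewrite (vf_cst xiU) (vf_cst etaU) addr0.
  + case: xiU etaU => _ _ _ xiW [_ _ _ etaW] W a oW WU Wa.
    by apply: regD => //; [exact: xiW|exact: etaW].
- move=> a xi Ua xiU; do ?split=> //.
  + by move=> b c; rewrite (vfD xiU) mulrDr.
  + by move=> b c; rewrite (vfM xiU); ring.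
  + by move=> c; rewrite (vf_cst xiU) mulr0.
  + case: xiU => _ _ _ xiW W b oW WU Wb.
    apply: regM => //; last exact: xiW.
    by apply: (proj1 (reg_sheaf X) U W).
- move=> a xi Ua xiU; do ?split=> //.
  by case: xiU => _ _ _; exact.
- move=> xi eta xiU etaU; do ?split=> //.
  + move=> a b; rewrite (vfD xiU) (vfD etaU) (vfD xiU) (vfD etaU).
    by rewrite opprD addrACA.
  + move=> a b; rewrite (vfM xiU) (vfM etaU) (vfD xiU) (vfD etaU).
    by rewrite !(vfM xiU, vfM etaU); ring.
  + move=> c; rewrite (vf_cst xiU) (vf_cst etaU).
    by rewrite (vf0 xiU) (vf0 etaU) subrr.
  + case: xiU etaU => _ _ _ xiW [_ _ _ etaW] W a oW WU Wa.
    apply: regD => //; first by apply: xiW => //; exact: etaW.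
    rewrite -mulN1r; apply: regM => //; first exact: regN1.
    by apply: etaW => //; exact: xiW.
Qed.

Lemma shift_s_dop_eq beta U P Q : nonempty_open U -> dop_eq U P Q ->
  dop_eq U (shift_s beta P) (shift_s beta Q).
Proof.
move=> oU; have son R' := @shift_s_on beta U R' oU.
have [[r0 r1] rN1] := (reg0 oU, reg1 oU, regN1 oU).
have rc : reg U (- rat_cst beta) by rewrite -mulN1r; apply/regM/reg_rat_cst.
set c := - rat_cst beta in rc.
have xic xi : vector_field U xi -> xi c = 0.
  by move=> xiU; rewrite (vfN xiU) (vf_cst xiU) oppr0.
have rfl R' : dop_on U R' -> dop_eq U R' R' by exact: dop_eq_refl.
elim=> {P Q} /=; rewrite -/c.
- by move=> P UP; apply/rfl/son.
- by move=> P Q _; exact: dop_eq_sym.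
- by move=> P Q P' _ + _; exact: dop_eq_trans.
- by move=> P P' Q Q' _ + _; exact: dop_eq_Add.
- by move=> P P' Q Q' _ + _; exact: dop_eq_Mul.
- by move=> *; apply: dop_eq_addA; exact: son.
- by move=> *; apply: dop_eq_addC; exact: son.
- by move=> *; apply: dop_eq_add0; exact: son.
- by move=> *; apply: dop_eq_addN; exact: son.
- by move=> *; apply: dop_eq_mulA; exact: son.
- by move=> *; apply: dop_eq_mul1l; exact: son.
- by move=> *; apply: dop_eq_mul1r; exact: son.
- by move=> *; apply: dop_eq_mulDl; exact: son.
- by move=> *; apply: dop_eq_mulDr; exact: son.
- exact: dop_eq_addFF.
- exact: dop_eq_FF.
- exact: dop_eq_VV.
- exact: dop_eq_FV.
- exact: dop_eq_comm.
- exact: dop_eq_bracket.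
- exact: dop_eq_TF.
- exact: dop_eq_TV.
- move=> a Ua; apply: dop_eq_trans (dop_eq_mulDl _ _ _) _ => //.
  apply: dop_eq_trans; last by apply: dop_eq_sym; exact: dop_eq_mulDr.
  apply: dop_eq_Add; first exact: dop_eq_SF.
  apply: dop_eq_trans (dop_eq_FF _ _) _ => //.
  by rewrite mulrC; apply/dop_eq_sym/dop_eq_FF.
- move=> xi xiU; apply: dop_eq_trans (dop_eq_mulDl _ _ _) _ => //.
  apply: dop_eq_trans; last by apply: dop_eq_sym; exact: dop_eq_mulDr.
  apply: dop_eq_Add; first exact: dop_eq_SV.
  apply: dop_eq_sym; apply: dop_eq_trans (dop_eq_comm _ _) _ => //.
  rewrite xic //; apply: dop_eq_trans (dop_eq_addC _ _) _ => //.
  exact: dop_eq_add0.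
- apply: dop_eq_trans (dop_eq_mulDl _ _ _) _ => //.
  apply: (@dop_eq_trans _ _ (DAdd (DMul Dt (DAdd Ds (DFun (- 1))))
                                  (DMul Dt (DFun c)))).
    apply: dop_eq_Add; first exact: dop_eq_ST.
    by apply: dop_eq_sym; exact: dop_eq_TF.
  apply: dop_eq_trans.
    by apply: dop_eq_sym; apply: dop_eq_mulDr.
  apply: dop_eq_Mul; first exact: rfl.
  apply: dop_eq_trans.
    by apply: dop_eq_sym; apply: dop_eq_addA.
  apply: dop_eq_trans (dop_eq_addA _ _ _) => //.
  by apply: dop_eq_Add; [exact: rfl|exact: dop_eq_addC].
- exact: dop_eq_TTinv.
- exact: dop_eq_TinvT.
Qed.

Section IotaPlus.
Variable f : K.
Hypotheses (f0 : f != 0) (fX : reg setT f).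

Lemma reg_restr U W a : nonempty_open U -> nonempty_open W -> W `<=` U ->
  reg U a -> reg W a.
Proof. by move=> oU oW WU; exact: (proj1 (reg_sheaf X) U W). Qed.

Lemma reg_f U : nonempty_open U -> reg U f.
Proof.
move=> oU; apply: reg_restr fX => //; split; first exact: openT.
by case: oU => _ [x _]; exists x.
Qed.

Lemma open_nbhd_in_nonempty U x W : open_nbhd_in U x W -> nonempty_open W.
Proof. by case=> oW Wx _; split=> //; exists x. Qed.

Lemma starH_reg U a : nonempty_open U -> reg U a -> sheaf_starH f U a.
Proof.
move=> oU Ua x Ux; exists 0%N, U; first by split=> //; case: oU.
by rewrite /sheaf_mH /= expr0 mul1r.
Qed.

Lemma starHD U a b : sheaf_starH f U a -> sheaf_starH f U b ->
  sheaf_starH f U (a + b).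
Proof.
move=> Ua Ub x Ux; have [m [W [oW Wx WU] Wa]] := Ua x Ux.
have [n [W' [oW' Wx' WU'] Wb]] := Ub x Ux.
have neW : nonempty_open W by split=> //; exists x.
have neW' : nonempty_open W' by split=> //; exists x.
have ne : nonempty_open (W `&` W') by split; [exact: openI|exists x].
exists (m + n)%N, (W `&` W').
  by split; [exact: openI| |by move=> y [/WU]].
rewrite /sheaf_mH /= mulrDr; apply: regD => //.
  rewrite addnC exprD -mulrA; apply: regM => //; first exact/regX/reg_f.
  by apply: reg_restr Wa => // y [].
rewrite exprD -mulrA; apply: regM => //; first exact/regX/reg_f.
by apply: reg_restr Wb => // y [].
Qed.

Lemma starHM U a b : sheaf_starH f U a -> sheaf_starH f U b ->
  sheaf_starH f U (a * b).
Proof.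
move=> Ua Ub x Ux; have [m [W [oW Wx WU] Wa]] := Ua x Ux.
have [n [W' [oW' Wx' WU'] Wb]] := Ub x Ux.
have neW : nonempty_open W by split=> //; exists x.
have neW' : nonempty_open W' by split=> //; exists x.
have ne : nonempty_open (W `&` W') by split; [exact: openI|exists x].
exists (m + n)%N, (W `&` W').
  by split; [exact: openI| |by move=> y [/WU]].
rewrite /sheaf_mH /= exprD mulrACA; apply: regM => //.
  by apply: reg_restr Wa => // y [].
by apply: reg_restr Wb => // y [].
Qed.

Lemma starHN U a : sheaf_starH f U a -> sheaf_starH f U (- a).
Proof.
move=> Ua x Ux; have [m [W xW Wa]] := Ua x Ux; exists m, W => //.
have oW := open_nbhd_in_nonempty xW.
by rewrite /sheaf_mH /= mulrN -mulN1r; apply: regM => //; exact: regN1.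
Qed.

Lemma starHV U : nonempty_open U -> sheaf_starH f U f^-1.
Proof.
move=> oU x Ux; exists 1%N, U; first by split=> //; case: oU.
by rewrite /sheaf_mH /= expr1 divff //; exact: reg1.
Qed.

Lemma starH_vf U xi a : vector_field U xi -> sheaf_starH f U a ->
  sheaf_starH f U (xi a).
Proof.
move=> xiU Ua x Ux; have [m [W xW Wa]] := Ua x Ux; exists m.+1, W => //.
have oW := open_nbhd_in_nonempty xW; have [_ _ WU] := xW.
have [_ _ _ xiW] := xiU; have rf := reg_f oW.
have xfm : f * xi (f ^+ m) = xi f * f ^+ m *+ m.
  elim: m {Wa} => [|m IH]; first by rewrite expr0 (vf1 xiU) mulr0 mulr0n.
  by rewrite exprS (vfM xiU) mulrDr IH; ring.
rewrite /sheaf_mH /=.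
have -> : f ^+ m.+1 * xi a = f * xi (f ^+ m * a) +
    (- 1) * (xi f * rat_cst m%:R * (f ^+ m * a)).
  rewrite (vfM xiU) mulrDr (mulrA f) xfm /rat_cst !ratr_nat rmorph_nat exprS.
  by ring.
apply: regD => //; first by apply: regM => //; exact: xiW.
apply: regM => //; first exact: regN1.
apply: regM => //; apply: regM => //; first exact: xiW.
exact: reg_rat_cst.
Qed.

Lemma iota_plusD U p q : iota_plus f U p -> iota_plus f U q ->
  iota_plus f U (p + q).
Proof. by move=> Up Uq j; rewrite coefD; exact: starHD. Qed.

Lemma iota_plusN U p : iota_plus f U p -> iota_plus f U (- p).
Proof. by move=> Up j; rewrite coefN; exact: starHN. Qed.

Lemma iota_plusZ U a p : sheaf_starH f U a -> iota_plus f U p ->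
  iota_plus f U (a *: p).
Proof. by move=> Ua Up j; rewrite coefZ; exact: starHM. Qed.

Lemma iota_plus0 U : nonempty_open U -> iota_plus f U 0.
Proof. by move=> oU j; rewrite coef0; exact/starH_reg/reg0. Qed.

Lemma iota_plus_deriv U p : nonempty_open U -> iota_plus f U p ->
  iota_plus f U p^`().
Proof.
move=> oU Up j; rewrite coef_deriv -mulr_natr; apply: starHM => //.
by apply: starH_reg => //; rewrite -(rmorph_nat (cst X)); case: (reg_subalgebra oU).
Qed.

Lemma iota_plus_dt U p : nonempty_open U -> iota_plus f U p ->
  iota_plus f U (dt_act p).
Proof.
move=> oU Up j; rewrite /dt_act coefXM; case: eqP => // _.
exact/starH_reg/reg0.
Qed.

Lemma iota_plus_act beta U P p : nonempty_open U -> dop_on U P ->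
  iota_plus f U p -> iota_plus f U (act f beta P p).
Proof.
move=> oU; have Uf := starH_reg oU (reg_f oU).
have Ut q : iota_plus f U q -> iota_plus f U (t_act f q).
  move=> Uq; apply: iota_plusD; first exact: iota_plusZ.
  exact/iota_plusN/iota_plus_deriv.
elim: P p => [a|xi|||| P IHP Q IHQ|P IHP Q IHQ] p /=.
- by move=> Ua Up; apply: iota_plusZ => //; exact: starH_reg.
- move=> xiU Up; have Uxf := starH_vf xiU Uf.
  apply: iota_plusD; last exact/iota_plusN/iota_plusZ/iota_plus_dt.
  move=> j; rewrite coef_poly; case: ifP => _; last exact/starH_reg/reg0.
  apply: starHD; first exact: starH_vf.
  apply: starHM => //; apply: starHM; last exact: starHV.
  by apply: starHM => //; apply: starH_reg => //; exact: reg_rat_cst.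
- by move=> _; exact: Ut.
- move=> _ Up; rewrite /tinv_act; elim/big_ind: _ => [||k _].
  + exact: iota_plus0.
  + exact: iota_plusD.
  + apply: iota_plusZ.
      rewrite -exprVn; elim: k.+1 => [|n IH].
        by rewrite expr0; exact/starH_reg/reg1.
      by rewrite exprS; apply: starHM => //; exact: starHV.
    elim: (k : nat) => [|n IH]; first by rewrite derivn0.
    by rewrite derivnS; exact: iota_plus_deriv.
- by move=> _ Up; exact/iota_plusN/iota_plus_dt/Ut.
- by move=> [UP UQ] Up; apply: iota_plusD; [exact: IHP|exact: IHQ].
- by move=> [UP UQ] Up; apply: IHP => //; exact: IHQ.
Qed.

End IotaPlus.

(** * V-filtrations *)

Section VFiltration.
Variables (f : K) (beta : rat).
Local Notation act := (act f beta).

(* [F] is a sheaf of sub-[D_X[t, d_t t]]-modules of [iota_+ M(f^beta)] *)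
Definition V0_submodule (F : set X -> set {poly K}) :=
  is_sheaf F /\
  forall U, nonempty_open U ->
    [/\ F U `<=` iota_plus f U, F U 0,
        forall m m', F U m -> F U m' -> F U (m + m') &
        forall P m, V0_on U P -> F U m -> F U (act P m)].

Definition V0_generated_by (F : set X -> set {poly K}) U n
    (g : 'I_n -> {poly K}) :=
  forall W m, nonempty_open W -> W `<=` U -> F W m ->
  forall y, W y -> exists2 W', open_nbhd_in W y W' &
    exists2 P : 'I_n -> dop, (forall i, V0_on W' (P i)) &
      m = \sum_(i < n) act (P i) (g i).

Definition V0_finite_type (F : set X -> set {poly K}) :=
  forall x : X, exists2 U, open_nbhd_in setT x U &
    exists (n : nat) (g : 'I_n -> {poly K}),
      (forall i, F U (g i)) /\ V0_generated_by F U g.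

Definition V0_relation n (g : 'I_n -> {poly K}) U (P : 'I_n -> dop) :=
  (forall i, V0_on U (P i)) /\ \sum_(i < n) act (P i) (g i) = 0.

(* Every morphism [(D_X[t, d_t t]|_U)^n -> F|_U] has a kernel of finite type *)
Definition V0_finite_relations (F : set X -> set {poly K}) :=
  forall U n (g : 'I_n -> {poly K}), nonempty_open U -> (forall i, F U (g i)) ->
  forall x, U x -> exists2 W, open_nbhd_in U x W &
    exists (k : nat) (r : 'I_k -> 'I_n -> dop),
      (forall j, V0_relation g W (r j)) /\
      forall W' P, nonempty_open W' -> W' `<=` W -> V0_relation g W' P ->
      forall y, W' y -> exists2 W'', open_nbhd_in W' y W'' &
        exists2 Q : 'I_k -> dop, (forall j, V0_on W'' (Q j)) &
          forall i, dop_eq W'' (P i) (dop_sum (fun j => DMul (Q j) (r j i))).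

Definition V0_coherent (F : set X -> set {poly K}) :=
  [/\ V0_submodule F, V0_finite_type F & V0_finite_relations F].

Definition V_above (V : rat -> set X -> set {poly K}) (gamma : rat) U :
    set {poly K} :=
  [set m | exists2 gamma', gamma < gamma' & V gamma' U m].

Definition dtt_sub (gamma : rat) (m : {poly K}) : {poly K} :=
  dt_act (t_act f m) - rat_cst gamma *: m.

Record is_V_filtration (V : rat -> set X -> set {poly K}) : Prop := {
  V_coherent : forall gamma, V0_coherent (V gamma);
  V_decreasing : forall gamma gamma' U, nonempty_open U ->
    gamma <= gamma' -> V gamma' U `<=` V gamma U;
  V_exhaustive : forall U m, nonempty_open U -> iota_plus f U m ->
    forall x, U x -> exists gamma,
      exists2 W, open_nbhd_in U x W & V gamma W m;
  V_discrete : exists2 l : nat, (0 < l)%N &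
    forall (i : int) (gamma gamma' : rat) U, nonempty_open U ->
      i%:~R / l%:R < gamma <= (i + 1)%:~R / l%:R ->
      i%:~R / l%:R < gamma' <= (i + 1)%:~R / l%:R ->
      V gamma U = V gamma' U;
  V_t : forall gamma U, nonempty_open U ->
    t_act f @` V gamma U `<=` V (gamma + 1) U;
  V_t_eq : forall gamma U, nonempty_open U -> 0 < gamma ->
    t_act f @` V gamma U = V (gamma + 1) U;
  V_dt : forall gamma U, nonempty_open U ->
    dt_act @` V gamma U `<=` V (gamma - 1) U;
  V_nilpotent : forall gamma, exists N : nat,
    forall U m, nonempty_open U -> V gamma U m ->
      V_above V gamma U (iter N (dtt_sub gamma) m)
}.

End VFiltration.

(** * Isomorphisms of modules *)

(* [Phi] is an isomorphism of sheaves of [D_X<t, t^-1, s>]-modules from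
   [iota_+ M(f^beta)] to [iota_+ O_X( *H)], on which the ring acts through
   [shift_s beta] *)
Record is_shifted_iso f (beta : rat)
    (Phi : set X -> {poly K} -> {poly K}) : Prop := {
  iso_restr : forall U W m, nonempty_open U -> nonempty_open W -> W `<=` U ->
    iota_plus f U m -> Phi W m = Phi U m;
  iso_bij : forall U, nonempty_open U ->
    set_bij (iota_plus f U) (iota_plus f U) (Phi U);
  iso_additive : forall U m m', nonempty_open U ->
    iota_plus f U m -> iota_plus f U m' -> Phi U (m + m') = Phi U m + Phi U m';
  iso_linear : forall U P m, nonempty_open U -> dop_on U P ->
    iota_plus f U m ->
    Phi U (act f beta P m) = act f 0 (shift_s beta P) (Phi U m)
}.

Definition Qpoly (i : nat) : {poly K} := \prod_(k < i) ('X + k%:R%:P).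

End DModules.

(* Main.v *)
(** On sections, written as polynomials in ['X = d_t], the operator [t / f] is
    [1 - f^-1 d/d'X], so its powers with rational exponents make sense as series
    of divided powers of the locally nilpotent [d/d'X]. The isomorphism is
    [(t / f)^(- beta)]: it commutes with [t], it moves [s] by [- beta] since
    [s t = t (s - 1)], and the factor [f^beta] accounts for the twist of the
    vector fields. The identity between [h] and [g] is Vandermonde's convolution
    for rising factorials.

    Transported to [iota_+ O_X( *H)] and reindexed by [(1/l) Z], the filtration
    [V^(gamma + beta)] satisfies the axioms of a [V]-filtration, except that
    [t V^gamma = V^(gamma + 1)] is only known for [gamma] large, and this is
    enough for uniqueness. On [V^i / V^(i+1)] and [V'^j / V'^(j+1)] the
    operator [d_t t] has the distinct generalized eigenvalues [i/l] and [j/l],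
    so that [V^i] meets [V'^j] in the sum of the intersections of [V^(i+1)]
    with [V'^j] and of [V^i] with [V'^(j+1)]. Iterating for [j < i], and using
    that [V^n] is locally contained in [V'^(j+1)] for [n] large because [V^n]
    is generated by powers of [t] from a module of finite type, one pushes the
    sections of [V^i] from [V'^j] into [V'^i]. *)
Require Import Defs.
From HB Require Import structures.
From mathcomp Require Import all_boot all_order all_algebra.
From mathcomp Require Import all_classical all_reals topology.
From mathcomp Require Import complex.
From mathcomp Require Import ring zify.
Set Implicit Arguments.
Unset Strict Implicit.
Unset Printing Implicit Defensive.
Import Order.TTheory GRing.Theory Num.Theory.
Local Open Scope classical_set_scope.
Local Open Scope ring_scope.

(** * Rising factorials and Vandermonde's convolution *)

Definition rising (A : comNzRingType) (x : A) (n : nat) : A :=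
  \prod_(k < n) (x + k%:R).

Section Rising.
Variable A : comNzRingType.
Implicit Types x y : A.

Lemma rising0 x : rising x 0 = 1.
Proof. by rewrite /rising big_ord0. Qed.

Lemma risingS x n : rising x n.+1 = rising x n * (x + n%:R).
Proof. by rewrite /rising big_ord_recr. Qed.

Lemma rising_at0 n : rising (0 : A) n = (n == 0%N)%:R.
Proof.
case: n => [|n]; first by rewrite rising0.
by rewrite /rising big_ord_recl /= addr0 mul0r.
Qed.

Lemma Vandermonde_rising x y n :
  rising (x + y) n = \sum_(i < n.+1) (rising x i * rising y (n - i)) *+ 'C(n, i).
Proof.
elim: n => [|n IH]; first by rewrite big_ord1 !rising0 mulr1.
rewrite risingS IH mulr_suml.
transitivity (\sum_(i < n.+1) (rising x i.+1 * rising y (n - i)) *+ 'C(n, i) +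
              \sum_(i < n.+1) (rising x i * rising y (n.+1 - i)) *+ 'C(n, i)).
  rewrite -big_split /=; apply: eq_bigr => i _.
  have le_in : (i <= n)%N by rewrite -ltnS.
  (* The new factor [x + y + n] splits as [(x + i) + (y + (n - i))], one part for each rising
     factorial; Pascal's rule then recombines the two sums. *)
  have -> : n%:R = i%:R + (n - i)%:R :> A by rewrite -natrD subnKC.
  rewrite subSn // !risingS mulrnAl -mulrnDl; congr (_ *+ _).
  by rewrite addrACA mulrDr mulrAC -[X in _ + X]mulrA.
rewrite addrC [RHS]big_ord_recl.
under [X in _ = _ + X]eq_bigr => i _ do rewrite lift0 binS mulrnDr subSS.
rewrite big_split addrA; congr (_ + _).
rewrite big_ord_recl [in RHS]big_ord_recr /= (bin_small (ltnSn n)).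
by rewrite mulr0n addr0 !bin0.
Qed.

End Rising.

(** * Power series in the derivative, with divided powers *)

Section DividedPowerOperators.
Variable A : comNzRingType.
Implicit Types (a b : nat -> A) (p q : {poly A}).

(** With D the derivative, this is the series of the a_j D^j / j!, so [a] is read through its
    exponential generating function. Terms past [size p] vanish. *)
Definition dpow a p : {poly A} := \sum_(j < size p) a j *: p^`N(j).

Lemma dpow_widen n a p : (size p <= n)%N ->
  dpow a p = \sum_(j < n) a j *: p^`N(j).
Proof.
move=> le_pn; rewrite /dpow -!(big_mkord xpredT (fun j => a j *: p^`N(j))).
rewrite [RHS](big_cat_nat (leq0n _) le_pn) //= [X in _ + X]big1_seq ?addr0 // => j.
rewrite mem_index_iota => /andP[_ /andP[le_pj _]].
by rewrite nderivn_poly0 // scaler0.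
Qed.

Lemma dpow_coef a p i :
  (dpow a p)`_i = \sum_(j < size p) (a j * p`_(j + i)) *+ 'C(j + i, j).
Proof.
rewrite coef_sum; apply: eq_bigr => j _.
by rewrite coefZ coef_nderivn mulrnAr.
Qed.

Lemma eq_dpow a b p : a =1 b -> dpow a p = dpow b p.
Proof. by move=> ab; apply: eq_bigr => j _; rewrite ab. Qed.

Lemma dpow_size a p : (size (dpow a p) <= size p)%N.
Proof.
apply/leq_sizeP => i le_pi; rewrite dpow_coef big1 // => j _.
by rewrite nth_default ?mulr0 ?mul0rn // (leq_trans le_pi) // leq_addl.
Qed.

Lemma dpowD a p q : dpow a (p + q) = dpow a p + dpow a q.
Proof.
pose n := maxn (size p) (size q).
rewrite !(@dpow_widen n) ?leq_maxl ?leq_maxr //; last first.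
  exact: size_polyD.
by rewrite -big_split /=; apply: eq_bigr => j _; rewrite nderivnD scalerDr.
Qed.

Lemma dpowZ a c p : dpow a (c *: p) = c *: dpow a p.
Proof.
rewrite (@dpow_widen (size p)) ?size_scale_leq // /dpow scaler_sumr.
by apply: eq_bigr => j _; rewrite nderivnZ !scalerA mulrC.
Qed.

Lemma dpowN a p : dpow a (- p) = - dpow a p.
Proof. by rewrite -scaleN1r dpowZ scaleN1r. Qed.

Lemma dpowB a p q : dpow a (p - q) = dpow a p - dpow a q.
Proof. by rewrite dpowD dpowN. Qed.

Lemma dpow_sum n a (P : 'I_n -> {poly A}) :
  dpow a (\sum_(i < n) P i) = \sum_(i < n) dpow a (P i).
Proof.
apply: (big_morph (dpow a) (dpowD a)).
by rewrite /dpow size_poly0 big_ord0.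
Qed.

Lemma dpow_addl a b p : dpow (fun j => a j + b j) p = dpow a p + dpow b p.
Proof. by rewrite -big_split; apply: eq_bigr => j _; rewrite scalerDl. Qed.

Lemma dpow_scalel c a p : dpow (fun j => c * a j) p = c *: dpow a p.
Proof. by rewrite scaler_sumr; apply: eq_bigr => j _; rewrite scalerA. Qed.

Lemma dpow_id p : dpow (fun j => (j == 0%N)%:R) p = p.
Proof.
rewrite (@dpow_widen (size p).+1) // big_ord_recl /= nderivn0 scale1r.
by rewrite big1 ?addr0 // => j _; rewrite scale0r.
Qed.

Lemma dpow_derivE p : dpow (fun j => (j == 1%N)%:R) p = p^`().
Proof.
rewrite (@dpow_widen (size p).+2) ?leqW // !big_ord_recl big1 ?addr0 => [|j _].
  by rewrite scale0r add0r scale1r nderivn1.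
by rewrite scale0r.
Qed.

Lemma nderivn_deriv p j : p^`()^`N(j) = p^`N(j.+1) *+ j.+1.
Proof.
apply/polyP => i; rewrite coefMn !coef_nderivn coef_deriv addSn.
rewrite -!mulrnA; congr (_ *+ _); rewrite [RHS]mulnC.
by rewrite mul_bin_diag.
Qed.

(** D times D^j / j! is j + 1 times D^(j+1) / (j+1)!. At [j = 0] the default [0.-1 = 0] is harmless,
    since the factor [j%:R] vanishes. *)
Lemma dpow_deriv a p : dpow a p^`() = dpow (fun j => (j%:R * a j.-1)) p.
Proof.
rewrite (@dpow_widen (size p)) //; last first.
  by rewrite (leq_trans (size_poly _ _)) // leq_pred.
rewrite [RHS](@dpow_widen (size p).+1) // big_ord_recl mul0r scale0r add0r.
apply: eq_bigr => j _.
by rewrite lift0 nderivn_deriv mulr_natl -scalerMnr scalerMnl.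
Qed.

Lemma nderivn_mulX p j : ('X * p)^`N(j.+1) = 'X * p^`N(j.+1) + p^`N(j).
Proof.
apply/polyP => i; rewrite coefD coefXM !coef_nderivn coefXM addSn /=.
case: i => [|i] /=; first by rewrite add0r !addn0 !binn.
by rewrite addSnnS -mulrnDr -binS.
Qed.

(** The commutator of a series A(D) with multiplication by ['X] is A'(D), and differentiating an
    exponential generating function shifts its sequence. *)
Lemma dpow_mulX a p : dpow a ('X * p) = 'X * dpow a p + dpow (fun j => a j.+1) p.
Proof.
rewrite (@dpow_widen (size p).+2); last first.
  by rewrite mulrC (leq_trans (size_polyMleq _ _)) // size_polyX addn2.
rewrite big_ord_recl nderivn0.
under eq_bigr => j _ do rewrite lift0 nderivn_mulX scalerDr.
rewrite big_split /= addrA; congr (_ + _); last first.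
  by rewrite [RHS](@dpow_widen (size p).+1).
rewrite [in RHS](@dpow_widen (size p).+2) ?leqW // mulr_sumr.
rewrite [RHS]big_ord_recl /= nderivn0 scalerAr; congr (_ + _).
by apply: eq_bigr => j _; rewrite scalerAr.
Qed.

Lemma nderivn_nderivn p i j : p^`N(i)^`N(j) = p^`N(i + j) *+ 'C(i + j, i).
Proof.
apply/polyP => k; rewrite coefMn !coef_nderivn -!mulrnA addnA.
congr (_ *+ _).
(* After this multiplication both products of binomials equal (i + j + k)!. *)
apply/eqP; rewrite -(@eqn_pmul2r (i`! * j`! * k`!)) ?muln_gt0 ?fact_gt0 //.
have e1 : 'C(i + j + k, i) * (i`! * (j + k)`!) = (i + j + k)`!.
  by have := @bin_fact (i + j + k) i; rewrite -addnA leq_addr addKn; exact.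
have e2 : 'C(j + k, j) * (j`! * k`!) = (j + k)`!.
  by have := @bin_fact (j + k) j; rewrite leq_addr addKn; exact.
have e3 : 'C(i + j + k, i + j) * ((i + j)`! * k`!) = (i + j + k)`!.
  by have := @bin_fact (i + j + k) (i + j); rewrite leq_addr addKn; exact.
have e4 : 'C(i + j, i) * (i`! * j`!) = (i + j)`!.
  by have := @bin_fact (i + j) i; rewrite leq_addr addKn; exact.
by apply/eqP; move: e1 e3; rewrite -e2 -e4; nia.
Qed.

(** A product of exponential generating functions has the binomial convolution as its sequence. *)
Lemma dpow_comp a b p :
  dpow a (dpow b p) =
  dpow (fun n => \sum_(i < n.+1) (b i * a (n - i)%N) *+ 'C(n, i)) p.
Proof.
set n := size p.
(* [G i m] pairs the term of order [i] of [b] with the term of order [m - i] of [a]; both sides sum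
   it over [i <= m < n]. *)
pose G i m := (b i * a (m - i)%N) *+ 'C(m, i) *: p^`N(m).
transitivity (\sum_(i < n) \sum_(m < n | (i <= m)%N) G i m); last first.
  rewrite (exchange_big_dep xpredT) //=; apply: eq_bigr => m _.
  by rewrite scaler_suml (big_ord_widen n (fun i => G i m)).
rewrite (@dpow_widen n) ?dpow_size //.
under eq_bigr => j _.
  rewrite (raddf_sum (nderivn j)) /= scaler_sumr.
  under eq_bigr => i _ do rewrite nderivnZ nderivn_nderivn.
  over.
rewrite exchange_big /=; apply: eq_bigr => i _.
have le_in : (i <= n)%N by exact: ltnW.
rewrite -(big_mkord (fun m => i <= m)%N (G i)).
rewrite -[RHS](@big_nat_widenl _ _ _ i 0 n xpredT) //.
(* Writing the lower bound as [0 + i] lets [big_addn] substitute [m = j + i]. *)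
have /(congr1 (fun k => \sum_(k <= m < n) G i m)) -> := esym (add0n i).
rewrite big_addn -(big_mkord xpredT (fun j =>
  a j *: (b i *: (p^`N(i + j) *+ 'C(i + j, i))))).
(* The terms with [n <= i + j] are divided derivatives of order at least [size p], hence zero. *)
rewrite (big_cat_nat (leq0n _) (leq_subr i n)) //= [X in _ + X]big1_seq ?addr0.
  apply: eq_bigr => j _.
  by rewrite /G addnK (addnC j) scalerA mulrC -scalerMnr scalerMnl.
move=> j; rewrite mem_index_iota leq_subLR => /andP[_ /andP[le_nj _]].
by rewrite nderivn_poly0 // mul0rn !scaler0.
Qed.

End DividedPowerOperators.

(** * The operator (t / f)^(- b) and its commutation relations *)

Section Twist.
Variables (R : realType) (X : variety R) (f : function_field X).
Hypothesis f0 : f != 0.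
Local Notation K := (function_field X).
Implicit Types (p q : {poly K}) (b c : rat) (U W : set X).

Lemma rat_cstD b c : rat_cst X (b + c) = rat_cst X b + rat_cst X c.
Proof. by rewrite /rat_cst !rmorphD. Qed.

Lemma rat_cstN b : rat_cst X (- b) = - rat_cst X b.
Proof. by rewrite /rat_cst !rmorphN. Qed.

Lemma rat_cst_nat n : rat_cst X n%:R = n%:R.
Proof. by rewrite /rat_cst ratr_nat rmorph_nat. Qed.

Lemma rat_cst_eq0 b : (rat_cst X b == 0) = (b == 0).
Proof. by rewrite /rat_cst !fmorph_eq0. Qed.

(* Informally [(t / f)^(- b)], where [t / f] is [1 - f^-1 d/d'X] on polynomials *)
Definition twist b p : {poly K} :=
  dpow (fun j => rising (rat_cst X b) j / f ^+ j) p.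

Lemma twistD b p q : twist b (p + q) = twist b p + twist b q.
Proof. exact: dpowD. Qed.

Lemma twistN b p : twist b (- p) = - twist b p.
Proof. exact: dpowN. Qed.

Lemma twistZ b a p : twist b (a *: p) = a *: twist b p.
Proof. exact: dpowZ. Qed.

Lemma twist_poly0 b : twist b 0 = 0.
Proof. by have := twistZ b 0 0; rewrite !scale0r. Qed.

Lemma twist_sum b n (P : 'I_n -> {poly K}) :
  twist b (\sum_(i < n) P i) = \sum_(i < n) twist b (P i).
Proof. exact: dpow_sum. Qed.

Lemma twist_size b p : (size (twist b p) <= size p)%N.
Proof. exact: dpow_size. Qed.

Lemma twist0 p : twist 0 p = p.
Proof.
rewrite -[RHS]dpow_id; apply: eq_dpow => j.
by rewrite rat_cst0 rising_at0; case: j => [|j]; rewrite ?mul0r // divr1.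
Qed.

(** Exponents add because the convolution of [dpow_comp] is Vandermonde's; in particular
    [twist (- b)] inverts [twist b]. *)
Lemma twist_comp b c p : twist b (twist c p) = twist (b + c) p.
Proof.
rewrite /twist dpow_comp; apply: eq_dpow => n.
rewrite rat_cstD addrC Vandermonde_rising mulr_suml; apply: eq_bigr => i _.
have le_in : (i <= n)%N by rewrite -ltnS.
by rewrite mulrnAl; congr (_ *+ _); rewrite mulrACA -invfM -exprD subnKC.
Qed.

Lemma twistK b : cancel (twist b) (twist (- b)).
Proof. by move=> p; rewrite twist_comp addNr twist0. Qed.

Lemma twistKV b : cancel (twist (- b)) (twist b).
Proof. by move=> p; rewrite twist_comp addrN twist0. Qed.

(** Both sides are series in D, where D itself has the indicator of 1 as its sequence. *)
Lemma twist_deriv b p : twist b p^`() = (twist b p)^`().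
Proof.
rewrite -(dpow_derivE (twist b p)) /twist dpow_deriv dpow_comp.
apply: eq_dpow => -[|n].
  by rewrite mul0r big_ord1 mulr0.
rewrite !big_ord_recr /= subnn mulr0 mul0rn addr0 subSnn mulr1.
rewrite big1 ?add0r => [|i _]; last first.
  by rewrite eqn_leq leq_subLR addn1 ltnS leqNgt ltn_ord mulr0 mul0rn.
by rewrite binSn mulr_natl.
Qed.

Lemma twist_t b p : twist b (t_act f p) = t_act f (twist b p).
Proof. by rewrite /t_act twistD twistN twistZ twist_deriv. Qed.

Lemma twist_tinv b p : twist b (tinv_act f p) = tinv_act f (twist b p).
Proof. by apply: (t_act_inj f0); rewrite -twist_t !tinv_actK. Qed.

Lemma twist_mulX b p : twist b ('X * p) = 'X * twist b p +
  dpow (fun j => rising (rat_cst X b) j * (rat_cst X b + j%:R) / f ^+ j.+1) p.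
Proof.
rewrite /twist dpow_mulX; congr (_ + _).
by apply: eq_dpow => j; rewrite risingS.
Qed.

(** As s is [- 'X] times t, the correction comes from the commutator with ['X]. It is the derivative
    of (1 - D/f)^(-b), that is b/f times (1 - D/f)^(-b-1); composed with t = f (1 - D/f) it gives
    back b times the twist. *)
Lemma twist_s b p :
  twist b (s_act f p) = s_act f (twist b p) - rat_cst X b *: twist b p.
Proof.
rewrite /s_act /dt_act twistN twist_mulX opprD twist_t; congr (_ - _).
rewrite /twist -dpow_scalel /t_act dpowB dpowZ dpow_deriv -dpow_scalel.
apply/eqP; rewrite subr_eq -dpow_addl; apply/eqP/eq_dpow => -[|j] /=.
  rewrite !rising0 expr1 expr0 addr0 mul1r !mul0r addr0 divr1 mulr1.
  by rewrite mulrCA divff ?mulr1.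
rewrite -(risingS _ j) (exprS f j.+1) invfM.
move: (rising _ _) (f ^+ _)^-1 => z w; rewrite (mulrCA f) mulVKf //.
by rewrite -mulrDl [RHS]mulrCA mulrA.
Qed.

(** A vector field acts by xi on coefficients, plus c xi(f)/f, minus xi(f) ['X]. Commuting the twist
    past the first part gives a factor j, past the last a factor b + j; the difference is b xi(f)/f
    times the twist, which lowers c to c - b. *)
Lemma twist_vec U xi b c p : vector_field U xi ->
  twist b (vec_act f c xi p) = vec_act f (c - b) xi (twist b p).
Proof.
move=> xiU; pose coefwise q := \poly_(j < size q) xi q`_j.
have coefwiseE q j : (coefwise q)`_j = xi q`_j.
  by rewrite coef_poly; case: ltnP => // qj; rewrite nth_default // (vf0 xiU).
have vecE d q : vec_act f d xi q =
    coefwise q + (rat_cst X d * xi f / f) *: q - xi f *: ('X * q).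
  apply/polyP => j; rewrite (vec_coef f d xiU) /vec_Mf !coefD coefN !coefZ coefXM.
  by rewrite coefwiseE [_ * q`_j]mulrC.
(* Rising factorials of [b] are constants, so xi only meets f^(-j), with derivative - j xi(f) /
   f^(j+1). *)
have coefwise_twist : coefwise (twist b p) = twist b (coefwise p) -
    dpow (fun j => xi f * (rising (rat_cst X b) j * j%:R / f ^+ j.+1)) p.
  have cD q r : coefwise (q + r) = coefwise q + coefwise r.
    by apply/polyP => j; rewrite coefD !coefwiseE coefD (vfD xiU).
  have c0 : coefwise 0 = 0.
    by apply/polyP => j; rewrite coefwiseE !coef0 (vf0 xiU).
  rewrite (big_morph coefwise cD c0).
  rewrite /twist [dpow _ (coefwise p)](@dpow_widen _ (size p)) ?size_poly //.
  rewrite -sumrB; apply: eq_bigr => j _; apply/polyP => i.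
  rewrite coefwiseE coefB !coefZ !coef_nderivn coefwiseE.
  rewrite (vfM xiU) (vfMn xiU) addrC.
  congr (_ + _); rewrite -mulNr; congr (_ * _).
  elim: (nat_of_ord j) => {j} [|j IH].
    by rewrite rising0 expr0 divr1 (vf1 xiU) mulr0 mul0r mulr0 oppr0.
  have e : rising (rat_cst X b) j.+1 / f ^+ j.+1 =
      rising (rat_cst X b) j / f ^+ j * ((rat_cst X b + j%:R) / f).
    by rewrite risingS exprSr invfM mulrACA.
  have xib : xi (rat_cst X b + j%:R) = 0.
    by rewrite -rat_cst_nat -rat_cstD; exact: (vf_cst xiU).
  rewrite mulrAC [f ^+ j.+2]exprSr invfM mulrA e.
  rewrite (vfM xiU) (vfM xiU) IH xib (vfV xiU f0).
  rewrite exprSr invfM -natr1 risingS.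
  move: (rising _ _) => z; move: (rat_cst X b) (j%:R) (f ^+ j)^-1 => w n v.
  by field.
rewrite !vecE !(twistD, twistN, twistZ) coefwise_twist twist_mulX.
rewrite rat_cstD rat_cstN.
set D := dpow _ p; set E := dpow _ p.
(* Termwise, the factor b + j in [D] is the factor j in [E] plus b. *)
have {}coefwise_twist : xi f *: D = E + (rat_cst X b * xi f / f) *: twist b p.
  rewrite /D /E /twist -!dpow_scalel -dpow_addl; apply: eq_dpow => j.
  rewrite exprSr invfM.
  move: (rising _ _) => z; move: (j%:R) (f ^+ j)^-1 => n v.
  by field.
apply/polyP => i; move/(congr1 (fun q : {poly K} => q`_i)): coefwise_twist.
rewrite scalerDr !(coefD, coefN, coefZ) => ->.
by field.
Qed.

(** The exponent [c] is left free: [c = b] serves for [twist b], and [c = 0] with [- b] for its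
    inverse. *)
Lemma twist_act U b c P p : dop_on U P ->
  twist b (act f c P p) = act f (c - b) (shift_s b P) (twist b p).
Proof.
elim: P p => [a|xi|||| P IHP Q IHQ|P IHP Q IHQ] p /=.
- by rewrite twistZ.
- exact: twist_vec.
- by rewrite twist_t.
- by rewrite twist_tinv.
- by rewrite twist_s scaleNr.
- by move=> [UP UQ]; rewrite twistD IHP // IHQ.
- by move=> [UP UQ]; rewrite IHP // IHQ.
Qed.

Lemma twist_iota_plus (hf : reg setT f) U b p : nonempty_open U ->
  iota_plus f U p -> iota_plus f U (twist b p).
Proof.
move=> oU Up; have rD := starHD hf; have rM := @starHM _ _ f.
have rc c : sheaf_starH f U (rat_cst X c).
  by apply: starH_reg => //; exact: reg_rat_cst.
have r1 : sheaf_starH f U 1 by have := rc 1%:R; rewrite rat_cst_nat.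
have r0 : sheaf_starH f U 0 by have := rc 0; rewrite rat_cst0.
move=> i; rewrite dpow_coef; apply: big_ind => // [|j _]; first exact: rD.
rewrite -mulr_natr -rat_cst_nat; apply: (rM) => //; apply: (rM) => //.
apply: (rM).
  by apply: big_ind => // [|k _]; [exact: (rM)|rewrite -rat_cst_nat -rat_cstD].
elim: (j : nat) => [|n IH]; first by rewrite expr0 invr1.
by rewrite exprSr invfM; apply: (rM) => //; exact: starHV.
Qed.

Lemma Qpoly_comp n q : Qpoly X n \Po q = rising q n.
Proof.
rewrite /Qpoly /rising rmorph_prod; apply: eq_bigr => k _.
by rewrite rmorphD /= comp_polyX comp_polyC rmorph_nat.
Qed.

(** The variable of [h] stands for d_t, that of [Qpoly] for s. Vandermonde expands Q_m(-s + b) in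
    the Q_i(-s), and the collected coefficient of Q_i(-s) is that of the twist over f^i. *)
Lemma twist_Qpoly b (h : {poly K}) n : (size h <= n)%N ->
  \sum_(i < n) (h`_i / f ^+ i) *:
     (Qpoly X i \Po (- 'X + (rat_cst X b)%:P)) =
  \sum_(i < n) ((twist b h)`_i / f ^+ i) *: (Qpoly X i \Po (- 'X)).
Proof.
move=> le_hn.
have risingC (c : K) j : rising c%:P j = (rising c j)%:P :> {poly K}.
  by rewrite /rising rmorph_prod; apply: eq_bigr => k _;
    rewrite rmorphD rmorph_nat.
pose G i m := (h`_m / f ^+ m * rising (rat_cst X b) (m - i) *+ 'C(m, i)) *:
  rising (- 'X : {poly K}) i.
transitivity (\sum_(i < n) \sum_(m < n | (i <= m)%N) G i m).
  rewrite (exchange_big_dep xpredT) //=; apply: eq_bigr => m _.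
  rewrite -(@big_ord_widen _ _ _ m.+1 n (fun i => G i m)) //.
  rewrite Qpoly_comp Vandermonde_rising.
  rewrite scaler_sumr; apply: eq_bigr => i _.
  rewrite /G risingC [_ * _%:P]mulrC mul_polyC -scalerMnr scalerA.
  by rewrite scalerMnl.
(* For fixed [i], substitute [m = j + i] and split f^m as f^j f^i. *)
apply: eq_bigr => i _; have le_in : (i <= n)%N by exact: ltnW.
rewrite -(big_mkord (fun m => i <= m)%N (G i)).
rewrite -[LHS](@big_nat_widenl _ _ _ i 0 n xpredT) //.
have /(congr1 (fun k => \sum_(k <= m < n) G i m)) -> := esym (add0n i).
rewrite big_addn Qpoly_comp.
rewrite /twist (@dpow_widen _ n) // coef_sum mulr_suml scaler_suml.
rewrite -(big_mkord xpredT (fun j => (((rising (rat_cst X b) j / f ^+ j) *: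
  h^`N(j))`_i / f ^+ i) *: rising (- 'X) i)).
rewrite [RHS](big_cat_nat (leq0n _) (leq_subr i n)) //=.
rewrite [X in _ = _ + X]big1_seq ?addr0 => [|j].
  apply: eq_bigr => j _; rewrite /G addnK coefZ coef_nderivn; congr (_ *: _).
  rewrite addnC -bin_sub ?leq_addr // addKn exprD invfM.
  rewrite mulrnAr mulrnAl; congr (_ *+ _).
  move: (rising _ _) (h`_ _) (f ^+ j)^-1 (f ^+ i)^-1 => u v w z.
  by ring.
rewrite mem_index_iota leq_subLR => /andP[_ /andP[le_nj _]].
rewrite coefZ coef_nderivn nth_default ?mul0rn ?mulr0 ?mul0r ?scale0r //.
by rewrite addnC (leq_trans le_hn).
Qed.

End Twist.

(** * Integrally indexed filtrations and the operators d_t t - gamma *)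

Section IntegralFiltrations.
Variables (R : realType) (X : variety R) (f : function_field X).
Hypotheses (f0 : f != 0) (hf : reg setT f).
Local Notation K := (function_field X).
Local Notation tt := (t_act f).
Implicit Types (m : {poly K}) (U W : set X) (i j : int).

Lemma open_nbhd_in_sub U W x W' : W `<=` U ->
  open_nbhd_in W x W' -> open_nbhd_in U x W'.
Proof. by move=> WU [oW' W'x W'W]; split=> // y /W'W /WU. Qed.

Lemma dtt_subE a b m :
  dtt_sub f a m = dtt_sub f b m + rat_cst X (b - a) *: m.
Proof. by rewrite /dtt_sub rat_cstD rat_cstN scalerBl addrA subrK. Qed.

Lemma dtt_subD a m m' : dtt_sub f a (m + m') = dtt_sub f a m + dtt_sub f a m'.
Proof.
by rewrite /dtt_sub /dt_act t_actD mulrDr scalerDr opprD addrACA.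
Qed.

Lemma dtt_subZ a (c : K) m : dtt_sub f a (c *: m) = c *: dtt_sub f a m.
Proof. by rewrite /dtt_sub /dt_act /t_act derivZ -!mul_polyC; ring. Qed.

Lemma dtt_subC a b m :
  dtt_sub f a (dtt_sub f b m) = dtt_sub f b (dtt_sub f a m).
Proof. by rewrite !(dtt_subE a b) dtt_subD dtt_subZ. Qed.

Lemma iter_dtt_subC a b n m :
  iter n (dtt_sub f a) (dtt_sub f b m) = dtt_sub f b (iter n (dtt_sub f a) m).
Proof. by elim: n => //= n ->; rewrite dtt_subC. Qed.

(* [(x - a)^N] and [(x - b)^M] are comaximal when [a != b] *)
Lemma dtt_sub_coprime (S : set {poly K}) (a b : rat) N M m : a != b ->
  (forall p q, S p -> S q -> S (p + q)) ->
  (forall c p, S p -> S (rat_cst X c *: p)) ->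
  (forall c p, S p -> S (dtt_sub f c p)) ->
  S (iter N (dtt_sub f a) m) -> S (iter M (dtt_sub f b) m) -> S m.
Proof.
move=> ab SD SZ Sdtt.
elim: N M m => [//|N IHN] M m; elim: M m => [//|M IHM] m SA SB.
have SAm : S (dtt_sub f a m).
  apply: (IHN M.+1); first by rewrite -iterSr.
  by rewrite iter_dtt_subC; exact: Sdtt.
have SBm : S (dtt_sub f b m).
  apply: IHM; last by rewrite -iterSr.
  by rewrite iter_dtt_subC; exact: Sdtt.
have ba : rat_cst X (b - a) != 0 by rewrite rat_cst_eq0 subr_eq0 eq_sym.
have -> : m = rat_cst X (b - a)^-1 *:
    (dtt_sub f a m + rat_cst X (-1) *: dtt_sub f b m).
  rewrite (dtt_subE a b) rat_cstN (rat_cst_nat X 1) scaleN1r addrAC subrr add0r.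
  by rewrite scalerA /rat_cst !fmorphV mulVf // scale1r.
by apply: (SZ); apply: (SD) => //; exact: SZ.
Qed.

(* The filtration [i |-> V^(i / l)] of [iota_+ O_X( *H)] *)
Record int_filtration (l : nat) (F : int -> set X -> set {poly K}) : Prop := {
  int_submodule : forall i, V0_submodule f 0 (F i);
  int_finite_type : forall i, V0_finite_type f 0 (F i);
  int_decreasing : forall i j U, nonempty_open U -> i <= j -> F j U `<=` F i U;
  int_exhaustive : forall U m, nonempty_open U -> iota_plus f U m ->
    forall x, U x -> exists i, exists2 W, open_nbhd_in U x W & F i W m;
  int_t : forall i U m, nonempty_open U -> F i U m -> F (i + l%:Z) U (tt m);
  int_t_eq : exists i0, forall i U m, nonempty_open U -> i0 <= i ->
    F (i + l%:Z) U m -> exists2 m', F i U m' & m = tt m';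
  int_nilpotent : forall i, exists N, forall U m, nonempty_open U ->
    F i U m -> F (i + 1) U (iter N (dtt_sub f (i%:~R / l%:R)) m)
}.

Section Submodules.
Variables (b : rat) (F : set X -> set {poly K}).
Hypothesis FV : V0_submodule f b F.
Variables (U : set X) (oU : nonempty_open U).

Lemma submodule_restr W m : nonempty_open W -> W `<=` U -> F U m -> F W m.
Proof. by move=> oW WU; have [[+ _] _] := FV; apply. Qed.

Lemma submodule_local m :
  (forall x, U x -> exists2 W, open_nbhd_in U x W & F W m) -> F U m.
Proof. by have [[_ +] _] := FV; apply. Qed.

Lemma submodule0 : F U 0.
Proof. by have [_ /(_ U oU)[]] := FV. Qed.

Lemma submoduleD m m' : F U m -> F U m' -> F U (m + m').
Proof. by have [_ /(_ U oU)[_ _ + _]] := FV; apply. Qed.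

Lemma submodule_iota m : F U m -> iota_plus f U m.
Proof. by have [_ /(_ U oU)[+ _ _ _]] := FV; apply. Qed.

Lemma submodule_act P m : V0_on U P -> F U m -> F U (act f b P m).
Proof. by have [_ /(_ U oU)[_ _ _ +]] := FV; apply. Qed.

Lemma submoduleZ c m : F U m -> F U (rat_cst X c *: m).
Proof.
by move=> Fm; apply: (submodule_act (P := DFun _)) => //; exact: reg_rat_cst.
Qed.

Lemma submodule_dtt_sub c m : F U m -> F U (dtt_sub f c m).
Proof.
move=> Fm.
have -> : dtt_sub f c m =
    act f b (DAdd (DMul (DFun (-1)) (@Ds _ X)) (DFun (rat_cst X (- c)))) m.
  by rewrite /= scaleN1r opprK rat_cstN scaleNr.
apply: submodule_act => //=; do ?split; first exact: regN1.
exact: reg_rat_cst.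
Qed.

Lemma submodule_iter_dtt_sub n c m : F U m -> F U (iter n (dtt_sub f c) m).
Proof. by move=> Fm; elim: n => //= n; exact: submodule_dtt_sub. Qed.

End Submodules.

(** * Inclusion between two integral filtrations *)

Section Comparison.
Variables (l : nat) (F F' : int -> set X -> set {poly K}).
Hypotheses (l0 : (0 < l)%N).
Hypotheses (FF : int_filtration l F) (FF' : int_filtration l F').

Let Fsub := int_submodule FF.
Let Fsub' := int_submodule FF'.

Lemma inter_split i j U m : nonempty_open U -> i != j ->
  F i U m -> F' j U m ->
  exists m1 m2, [/\ F (i + 1) U m1 /\ F' j U m1,
                    F i U m2 /\ F' (j + 1) U m2 & m = m1 + m2].
Proof.
move=> oU ij Fm Fm'.
(* Powers of d_t t - i/l and d_t t - j/l send [m] into the first and the second summand of [S]; as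
   i/l and j/l differ, [m] itself lies in [S]. *)
pose S := [set p | exists m1 m2, [/\ F (i + 1) U m1 /\ F' j U m1,
                    F i U m2 /\ F' (j + 1) U m2 & p = m1 + m2]].
have [N HN] := int_nilpotent FF i; have [M HM] := int_nilpotent FF' j.
suff : S m by [].
have ijl : i%:~R / l%:R != j%:~R / l%:R :> rat.
  apply: contra ij => /eqP/(congr1 ( *%R^~ l%:R)).
  by rewrite !divfK ?pnatr_eq0 -?lt0n // => /intr_inj ->.
apply: (dtt_sub_coprime (N := N) (M := M) ijl) => /=.
- move=> p q [m1 [m2 [[a1 b1] [a2 b2] ->]]] [m3 [m4 [[a3 b3] [a4 b4] ->]]].
  exists (m1 + m3), (m2 + m4); rewrite addrACA; split=> //; split.
  + exact: (submoduleD (Fsub _)).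
  + exact: (submoduleD (Fsub' _)).
  + exact: (submoduleD (Fsub _)).
  + exact: (submoduleD (Fsub' _)).
- move=> c p [m1 [m2 [[a1 b1] [a2 b2] ->]]].
  exists (rat_cst X c *: m1), (rat_cst X c *: m2).
  rewrite scalerDr; split=> //; split.
  + exact: (submoduleZ (Fsub _)).
  + exact: (submoduleZ (Fsub' _)).
  + exact: (submoduleZ (Fsub _)).
  + exact: (submoduleZ (Fsub' _)).
- move=> c p [m1 [m2 [[a1 b1] [a2 b2] ->]]].
  exists (dtt_sub f c m1), (dtt_sub f c m2).
  rewrite dtt_subD; split=> //; split.
  + exact: (submodule_dtt_sub (Fsub _)).
  + exact: (submodule_dtt_sub (Fsub' _)).
  + exact: (submodule_dtt_sub (Fsub _)).
  + exact: (submodule_dtt_sub (Fsub' _)).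
- exists (iter N (dtt_sub f (i%:~R / l%:R)) m), 0.
  rewrite addr0; split=> //; split.
  + exact: HN.
  + exact: (submodule_iter_dtt_sub (Fsub' _)).
  + exact: (submodule0 (Fsub _)).
  + exact: (submodule0 (Fsub' _)).
- exists 0, (iter M (dtt_sub f (j%:~R / l%:R)) m).
  rewrite add0r; split=> //; split.
  + exact: (submodule0 (Fsub _)).
  + exact: (submodule0 (Fsub' _)).
  + exact: (submodule_iter_dtt_sub (Fsub _)).
  + exact: HM.
Qed.

(** Only the first summand is split again; [j < i] keeps [i + n] different from [j], and what is
    split off accumulates in the second summand. *)
Lemma inter_split_iter n i j U m : nonempty_open U -> j < i ->
  F i U m -> F' j U m ->
  exists m1 m2, [/\ F (i + n%:Z) U m1 /\ F' j U m1,
                    F i U m2 /\ F' (j + 1) U m2 & m = m1 + m2].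
Proof.
move=> oU ji Fm Fm'; elim: n => [|n [m1 [m2 [[a1 b1] [a2 b2] ->]]]].
  exists m, 0; rewrite !addr0; split=> //; split.
    exact: (submodule0 (Fsub _)).
  exact: (submodule0 (Fsub' _)).
have inj : i + n%:Z != j.
  by rewrite gt_eqF // (lt_le_trans ji) // lerDl.
have [m3 [m4 [[a3 b3] [a4 b4] ->]]] := inter_split oU inj a1 b1.
exists m3, (m4 + m2); rewrite addrA; split=> //; split=> //.
- by rewrite -addn1 PoszD addrA.
- apply: (submoduleD (Fsub _)) => //.
  by apply: (int_decreasing FF oU) a4; rewrite lerDl.
- exact: (submoduleD (Fsub' _)).
Qed.

(** Exhaustiveness gives a level and a neighbourhood for each section; a finite list allows the
    minimum of the levels and the intersection of the neighbourhoods. *)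
Lemma common_level (s : seq {poly K}) U x : open_nbhd_in setT x U ->
  (forall m, m \in s -> iota_plus f U m) ->
  exists c, exists2 W, open_nbhd_in U x W & forall m, m \in s -> F' c W m.
Proof.
move=> xU; have oU := open_nbhd_in_nonempty xU; have [_ Ux _] := xU.
elim: s => [|g s IH] sU; first by exists 0, U => //; split=> //; case: xU.
have [m ms|c [W xW Wc]] := IH; first by apply: sU; rewrite inE ms orbT.
have [d [W' xW' Wd]] := int_exhaustive FF' oU (sU _ (mem_head _ _)) Ux.
have xWW' : open_nbhd_in U x (W `&` W').
  case: xW xW' => [oW Wx WU] [oW' W'x W'U].
  by split; [exact: openI | | move=> y [/WU]].
have ne := open_nbhd_in_nonempty xWW'.
exists (Num.min c d), (W `&` W') => // m; rewrite inE => /predU1P[->|ms].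
  apply: (int_decreasing FF' ne (j := d)); first by rewrite ge_min lexx orbT.
  by apply: (submodule_restr (Fsub' _) (open_nbhd_in_nonempty xW')).
apply: (int_decreasing FF' ne (j := c)); first by rewrite ge_min lexx.
apply: (submodule_restr (Fsub' _) (open_nbhd_in_nonempty xW)) (Wc _ ms) => //.
Qed.

(** Local generators of [F k] lie in a common [F' c], which is stable under the operators of
    [V0_on]. *)
Lemma finite_type_bounded k x : exists c, exists2 U, open_nbhd_in setT x U &
  forall W m, nonempty_open W -> W `<=` U -> F k W m -> F' c W m.
Proof.
have [U xU [n [g [gU Fgen]]]] := int_finite_type FF k x.
have oU := open_nbhd_in_nonempty xU.
have [m|c [U1 xU1 gU1]] := @common_level (codom g) U x xU.
  by move=> /codomP[q ->]; exact: (submodule_iota (Fsub k) oU).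
have oU1 := open_nbhd_in_nonempty xU1.
exists c, U1; first by apply: open_nbhd_in_sub xU1.
move=> W m oW WU1 Fm; apply: (submodule_local (Fsub' c) oW) => y Wy.
have [_ _ U1U] := xU1.
have [W' yW' [P PW' ->]] := Fgen W m oW (subset_trans WU1 U1U) Fm y Wy.
exists W' => //; have oW' := open_nbhd_in_nonempty yW'; have [_ _ W'W] := yW'.
apply: big_ind; first exact: (submodule0 (Fsub' _)).
  by move=> ? ?; exact: (submoduleD (Fsub' _)).
move=> q _; apply: (submodule_act (Fsub' _)) => //.
apply: (submodule_restr (Fsub' c) oU1) => //; last exact/gU1/codom_f.
exact: subset_trans W'W WU1.
Qed.

(** For [k] in the range where t is onto, F^(k + r l) = t^r F^k, and t^r sends F'^c into F'^(c + r
    l), which lies in F'^j for [r] large. *)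
Lemma eventually_bounded i j x : exists n : nat,
  exists2 U, open_nbhd_in setT x U &
  forall W m, nonempty_open W -> W `<=` U -> F (i + n%:Z) W m -> F' j W m.
Proof.
have [i0 Ft] := int_t_eq FF.
pose k := Num.max i i0; have [c [U xU FU]] := finite_type_bounded k x.
pose r := `|j - c|%N.
have ik : i <= k by rewrite le_max lexx.
(* This makes [i + n = k + r * l]; [r = |j - c|] suffices because [l >= 1]. *)
exists (`|k - i| + r * l)%N, U => // W m oW WU.
have -> : i + (`|k - i| + r * l)%N%:Z = k + r%:Z * l%:Z.
  by rewrite PoszD PoszM gez0_abs ?subr_ge0 // addrA subrKC.
move=> Fm; have [m' Fm' ->] : exists2 m', F k W m' & m = iter r tt m'.
  elim: (r) m Fm => [|n IH] m; first by rewrite mul0r addr0; exists m.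
  rewrite -addn1 PoszD mulrDl mul1r addrA => /Ft[//||m1 /IH[m2 Fm2 ->] ->].
    by rewrite (le_trans _ (_ : k <= _)) ?le_max ?lexx ?orbT // lerDl mulr_ge0.
  by exists m2; rewrite // addn1.
have {}Fm' : F' (c + r%:Z * l%:Z) W (iter r tt m').
  elim: (r) => [|n IH]; first by rewrite mul0r addr0; exact: FU.
  by rewrite -addn1 PoszD mulrDl mul1r addrA addn1; exact: (int_t FF').
apply: (int_decreasing FF' oW) Fm'.
rewrite -lerBlDl (le_trans (ler_norm _)) // abszE ler_peMr //.
Qed.

(** Near each point, the first summand of [inter_split_iter] is pushed deep enough in [F] to fall
    into [F' (j + 1)], where the second already is. *)
Lemma comparison_step i j U m : nonempty_open U -> j < i ->
  F i U m -> F' j U m -> F' (j + 1) U m.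
Proof.
move=> oU ji Fm Fm'; apply: (submodule_local (Fsub' _) oU) => x Ux.
have [n [U0 [oU0 U0x _] FU0]] := eventually_bounded i (j + 1) x.
have xW : open_nbhd_in U x (U `&` U0).
  by split; [apply: openI => //; case: oU | | move=> y []].
have oW := open_nbhd_in_nonempty xW; exists (U `&` U0) => //.
have [m1 [m2 [[a1 b1] [a2 b2] ->]]] := inter_split_iter n oU ji Fm Fm'.
have WU : U `&` U0 `<=` U by move=> y [].
apply: (submoduleD (Fsub' _)) => //; last exact: (submodule_restr (Fsub' _) oU).
apply: FU0 => //.
exact: (submodule_restr (Fsub _) oU).
Qed.

Lemma int_filtration_sub i U : nonempty_open U -> F i U `<=` F' i U.
Proof.
move=> oU m Fm; apply: (submodule_local (Fsub' _) oU) => x Ux.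
have [j [W xW Fm']] := int_exhaustive FF' oU (submodule_iota (Fsub i) oU Fm) Ux.
have oW := open_nbhd_in_nonempty xW; exists W => //.
have {}Fm : F i W m by apply: (submodule_restr (Fsub i) oU) Fm => //; case: xW.
have [ij|ji] := leP i j; first exact: (int_decreasing FF' oW ij).
(* The level in [F'] climbs by one as long as it is below [i]. *)
have H n : j + n%:Z <= i -> F' (j + n%:Z) W m.
  elim: n => [|n IH]; first by rewrite addr0.
  rewrite -addn1 PoszD addrA lezD1 => jni.
  by apply: (comparison_step oW jni) => //; exact/IH/ltW.
have ij0 : 0 <= i - j by rewrite subr_ge0 ltW.
by have := H `|i - j|%N; rewrite gez0_abs // subrKC; apply.
Qed.

End Comparison.

Lemma int_filtration_unique l F F' i U : (0 < l)%N ->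
  int_filtration l F -> int_filtration l F' -> nonempty_open U ->
  F i U = F' i U.
Proof.
move=> l0 FF FF' oU; apply/seteqP.
by split; apply: (int_filtration_sub l0).
Qed.

End IntegralFiltrations.

(** * Transport of V-filtrations along the twist *)

Section Transport.
Variables (R : realType) (X : variety R) (f : function_field X).
Hypotheses (f0 : f != 0) (hf : reg setT f).
Local Notation K := (function_field X).
Implicit Types (m : {poly K}) (U W : set X) (i : int).

Lemma V0_on_dop_on U (P : dop X) : V0_on U P -> dop_on U P.
Proof. by elim: P => //= P IHP Q IHQ [/IHP ? /IHQ ?]. Qed.

Lemma V0_on_shift_s b U (P : dop X) : nonempty_open U ->
  V0_on U P -> V0_on U (shift_s b P).
Proof.
move=> oU.
elim: P => //= [_|P IHP Q IHQ [/IHP ? /IHQ ?]|P IHP Q IHQ [/IHP ? /IHQ ?]] //.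
by split=> //; rewrite -rat_cstN; exact: reg_rat_cst.
Qed.

(** Discreteness for a given denominator, isolated so that denominators can be refined. *)
Definition constant_on_steps (l : nat) (V : rat -> set X -> set {poly K}) :=
  forall i (gamma gamma' : rat) U, nonempty_open U ->
    i%:~R / l%:R < gamma <= (i + 1)%:~R / l%:R ->
    i%:~R / l%:R < gamma' <= (i + 1)%:~R / l%:R ->
    V gamma U = V gamma' U.

(** The interval of length 1/(l k) with index [i] lies in that of length 1/l whose index is the
    floor of i/k. *)
Lemma constant_on_steps_mul l k V : (0 < l)%N -> (0 < k)%N ->
  constant_on_steps l V -> constant_on_steps (l * k) V.
Proof.
move=> l0 k0 Vl i.
have kZ : k%:Z != 0 by rewrite gt_eqF.
have e1 : (i %/ k)%Z%:~R / l%:R <= i%:~R / (l * k)%:R :> rat.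
  rewrite natrM invfM mulrA mulrAC ler_pM2r ?invr_gt0 ?ltr0n //.
  rewrite ler_pdivlMr ?ltr0n // -[k%:R]/(k%:Z%:~R) -intrM ler_int.
  exact: lez_floor.
have e2 : (i + 1)%:~R / (l * k)%:R <= ((i %/ k)%Z + 1)%:~R / l%:R :> rat.
  rewrite natrM invfM mulrA mulrAC ler_pM2r ?invr_gt0 ?ltr0n //.
  rewrite ler_pdivrMr ?ltr0n // -[k%:R]/(k%:Z%:~R) -intrM ler_int lezD1.
  by rewrite ltz_ceil.
move=> g g' U oU /andP[a1 a2] /andP[b1 b2]; apply: (Vl (i %/ k)%Z) => //.
  by rewrite (le_lt_trans e1 a1) (le_trans a2 e2).
by rewrite (le_lt_trans e1 b1) (le_trans b2 e2).
Qed.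

Lemma twist_dtt_sub b c m :
  twist f b (dtt_sub f c m) = dtt_sub f (c - b) (twist f b m).
Proof.
have dttE d p : dtt_sub f d p = - s_act f p - rat_cst X d *: p.
  by rewrite /s_act opprK.
rewrite !dttE twistD (twistN _ _ (s_act f m)) (twist_s f0) twistN twistZ.
by rewrite rat_cstD rat_cstN scalerBl !opprB [RHS]addrA [X in _ = X - _]addrC.
Qed.

Lemma twist_iter_dtt_sub b c n m : twist f b (iter n (dtt_sub f c) m) =
  iter n (dtt_sub f (c - b)) (twist f b m).
Proof. by elim: n => //= n IH; rewrite twist_dtt_sub IH. Qed.

Section Reindex.
Variables (b : rat) (V : rat -> set X -> set {poly K}) (l : nat) (z : int).
Hypotheses (VV : is_V_filtration f b V) (l0 : (0 < l)%N).
Hypotheses (Vl : constant_on_steps l V) (bz : b = z%:~R / l%:R).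

(** The image of V^(i/l + b) under [twist f b], written as a preimage under the inverse. *)
Definition reindex i U : set {poly K} :=
  [set m | V (i%:~R / l%:R + b) U (twist f (- b) m)].

Lemma V_submodule g : V0_submodule f b (V g).
Proof. by have [] := V_coherent VV g. Qed.

Lemma twistN_act U P m : dop_on U P -> twist f (- b) (act f 0 P m) =
  act f b (shift_s (- b) P) (twist f (- b) m).
Proof. by move=> UP; rewrite (twist_act f0 _ _ _ UP) opprK add0r. Qed.

Lemma twist_act0 U P m : dop_on U P -> twist f b (act f b P m) =
  act f 0 (shift_s b P) (twist f b m).
Proof. by move=> UP; rewrite (twist_act f0 _ _ _ UP) subrr. Qed.

Lemma reindex_submodule i : V0_submodule f 0 (reindex i).
Proof.
have Vs := V_submodule (i%:~R / l%:R + b); split.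
  split; first by move=> U W oU oW WU m; exact: (submodule_restr Vs oU oW WU).
  by move=> U m oU; exact: (submodule_local Vs oU).
move=> U oU; split.
- move=> m Vm; rewrite -(twistKV f b m).
  exact/twist_iota_plus/(submodule_iota Vs oU).
- by rewrite /reindex /= twist_poly0; exact: (submodule0 Vs oU).
- by move=> m m' Vm Vm'; rewrite /reindex /= twistD; exact: (submoduleD Vs oU).
- move=> P m UP Vm; rewrite /reindex /= (twistN_act _ (V0_on_dop_on UP)).
  by apply: (submodule_act Vs) => //; exact: V0_on_shift_s.
Qed.

Lemma reindex_finite_type i : V0_finite_type f 0 (reindex i).
Proof.
have [_ Vft _] := V_coherent VV (i%:~R / l%:R + b).
move=> x; have [U xU [n [g [gU gen]]]] := Vft x; exists U => //.
exists n, (fun q => twist f b (g q)); split.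
  by move=> q; rewrite /reindex /= twistK.
move=> W m oW WU Vm y Wy; have [W' yW' [P PW' e]] := gen W _ oW WU Vm y Wy.
have oW' := open_nbhd_in_nonempty yW'.
exists W' => //; exists (fun q => shift_s b (P q)).
  by move=> q; exact: V0_on_shift_s.
rewrite -[LHS](twistKV f b) e twist_sum; apply: eq_bigr => q _.
exact/twist_act0/V0_on_dop_on/PW'.
Qed.

Let lR : 0 < l%:R :> rat. Proof. by rewrite ltr0n. Qed.

Lemma reindex_int_filtration : int_filtration f l reindex.
Proof.
split; [exact: reindex_submodule|exact: reindex_finite_type|..].
- move=> i j U oU ij m; apply: (V_decreasing VV oU).
  by rewrite lerD2r ler_pM2r ?invr_gt0 // ler_int.
- move=> U m oU Um x Ux.
  have Um' := twist_iota_plus f0 hf (- b) oU Um.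
  have [g [W xW Wm]] := V_exhaustive VV oU Um' Ux.
  (* The largest [i] with i/l + b <= g. *)
  exists (Num.floor ((g - b) * l%:R)), W => //.
  apply: (V_decreasing VV (open_nbhd_in_nonempty xW) _ Wm).
  by rewrite -lerBrDr ler_pdivrMr // floor_le.
- move=> i U m oU Vm; rewrite /reindex /= twist_t // intrD mulrDl divff ?gt_eqF //.
  by rewrite addrAC; apply: (V_t VV oU); exists (twist f (- b) m).
(* From this index on i/l + b is positive, the range where [V_t_eq] applies. *)
- exists (Num.floor (- b * l%:R) + 1) => i U m oU le_i.
  have pos : 0 < i%:~R / l%:R + b.
    rewrite -ltrBlDr sub0r ltr_pdivlMr //.
    by rewrite (lt_le_trans (floorD1_gt _)) // ler_int.
  rewrite /reindex /= intrD mulrDl divff ?gt_eqF // addrAC.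
  rewrite -(V_t_eq VV oU pos) => -[m0 Vm0 e].
  exists (twist f b m0); first by rewrite twistK.
  by rewrite -twist_t // e twistKV.
- move=> i; have [N HN] := V_nilpotent VV (i%:~R / l%:R + b); exists N => U m oU Vm.
  rewrite /reindex /= twist_iter_dtt_sub opprK.
  have [g lt_g Vg] := HN U _ oU Vm.
  have stepE j : j%:~R / l%:R + b = (j + z)%:~R / l%:R.
    by rewrite bz intrD mulrDl.
  (* Nilpotency only reaches some V^g with g > i/l + b. If g is short of the next step, constancy
     applies, as [b] is a multiple of 1/l. *)
  have [le_g|lt_g'] := leP ((i + 1)%:~R / l%:R + b) g.
    exact: (V_decreasing VV oU le_g).
  have -> : V ((i + 1)%:~R / l%:R + b) U = V g U; last by [].
  apply: (Vl (i := i + z)) => //; rewrite addrAC -!stepE.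
    by rewrite lexx andbT ltrD2r ltr_pM2r ?invr_gt0 // ltr_int ltrDl.
  by rewrite lt_g ltW.
Qed.

Lemma twist_image i g U : nonempty_open U ->
  (i - 1)%:~R / l%:R < g <= i%:~R / l%:R ->
  twist f b @` V g U = reindex (i - z) U.
Proof.
move=> oU gi; have iz : (i - z)%:~R / l%:R + b = i%:~R / l%:R.
  by rewrite bz -mulrDl -intrD subrK.
have -> : V g U = V (i%:~R / l%:R) U.
  apply: (Vl (i := i - 1)) => //; rewrite subrK // lexx andbT.
  by rewrite ltr_pM2r ?invr_gt0 // ltr_int gtrDl.
rewrite /reindex iz; apply/seteqP; split=> [_ [m Vm <-]|m Vm].
  by rewrite /= twistK.
by exists (twist f (- b) m) => //; rewrite twistKV.
Qed.

End Reindex.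

Lemma twist_V_filtration b V V' g U :
  is_V_filtration f b V -> is_V_filtration f 0 V' -> nonempty_open U ->
  twist f b @` V g U = V' (g - b) U.
Proof.
move=> VV VV' oU.
have [l l0 Vl] := V_discrete VV; have [l' l'0 Vl'] := V_discrete VV'.
(* [n] is a common denominator for both filtrations and [b]. *)
pose d := `|denq b|%N; have d0 : (0 < d)%N by rewrite absz_gt0 denq_neq0.
pose n := (l * (l' * d))%N.
have n0 : (0 < n)%N by rewrite !muln_gt0 l0 l'0.
have nR : 0 < n%:R :> rat by rewrite ltr0n.
have Vn : constant_on_steps n V.
  by apply: constant_on_steps_mul; rewrite ?muln_gt0 ?l'0.
have Vn' : constant_on_steps n V'.
  rewrite /n mulnCA; apply: constant_on_steps_mul => //.
  by rewrite muln_gt0 l0.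
pose z := numq b * (l * l')%N%:Z.
have bz : b = z%:~R / n%:R.
  have dE : d%:R = (denq b)%:~R :> rat by rewrite -absz_denq.
  rewrite /z /n mulnA natrM intrM invfM mulrA mulfK; last first.
    by rewrite intr_eq0 eqz_nat -lt0n muln_gt0 l0.
  by rewrite dE divq_num_den.
(* [V'] is also put in the form [reindex], with shift 0, where the twist is the identity. *)
have z0 : 0 = 0%:~R / n%:R :> rat by rewrite mul0r.
pose i := Num.ceil (g * n%:R).
have gi : (i - 1)%:~R / n%:R < g <= i%:~R / n%:R.
  by rewrite ltr_pdivrMr // ler_pdivlMr // ceil_ge ceilB1_lt.
rewrite (twist_image n0 Vn bz oU gi).
have gi' : (i - z - 1)%:~R / n%:R < g - b <= (i - z)%:~R / n%:R.
  rewrite addrAC !(intrD _ _ (- z)) !(mulrDl _ _ n%:R^-1) intrN mulNr -bz.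
  by rewrite ltrD2r lerD2r.
rewrite (int_filtration_unique _ n0 (reindex_int_filtration VV n0 Vn bz)
  (reindex_int_filtration VV' n0 Vn' z0) oU).
rewrite -[X in reindex _ _ _ X](subr0 (i - z)) -(twist_image n0 Vn' z0 oU gi').
by apply/seteqP; split=> [_ [m Vm <-]|m Vm];
  [rewrite twist0|exists m; rewrite ?twist0].
Qed.

End Transport.

(** * The isomorphism, its formula and its effect on V-filtrations *)

Theorem proposition2p6 (R : realType) (X : variety R) (hX : is_smooth X)
    (f : function_field X) (hf : @reg R X setT f) (hf0 : f != 0)
    (beta : rat) :
  exists Phi : set X -> {poly function_field X} -> {poly function_field X},
    [/\ is_shifted_iso f beta Phi,
        (forall (U : set X) (p : nat) (h : {poly function_field X}),
           nonempty_open U -> iota_plus f U h -> (size h <= p.+1)%N ->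
           let g := Phi U h in
           (size g <= p.+1)%N /\
           \sum_(i < p.+1) (h`_i / f ^+ i) *:
              (Qpoly X i \Po (- 'X + (rat_cst X beta)%:P)) =
           \sum_(i < p.+1) (g`_i / f ^+ i) *: (Qpoly X i \Po (- 'X))) &
        (forall V V' : rat -> set X -> set {poly function_field X},
           is_V_filtration f beta V -> is_V_filtration f 0 V' ->
           forall (gamma : rat) (U : set X), nonempty_open U ->
             Phi U @` V gamma U = V' (gamma - beta) U)].
Proof.
(* The coefficients of the twist are global, so the same map serves on every open set. *)
exists (fun _ => twist f beta); split.
- split=> // [U oU|U m m' _ _ _|U P m oU UP _].
  + split=> [m Um|m m' _ _|m Um].
    * exact: twist_iota_plus.
    * exact: (can_inj (twistK f beta)).
    * exists (twist f (- beta) m); last exact: twistKV.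
      exact: twist_iota_plus.
  + exact: twistD.
  + by rewrite (twist_act hf0 _ _ _ UP) subrr.
- move=> U p h _ _ le_hp; split; first exact: leq_trans (twist_size _ _ _) le_hp.
  exact: twist_Qpoly.
- by move=> V V' VV VV' gamma U oU; exact: twist_V_filtration.
Qed.
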